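(* Let $A:X\to Y$ be a bounded linear operator between Banach spaces over $\mathbb{K}\in\{\mathbb{R},\mathbb{C}\}$. (i) $A$ is asymptotically uniformly flattenable if and only if there exists $C>0$ such that $A$ satisfies $C$-$c_0$ upper tree estimates. (ii) For any $1<p<\infty$, $A$ is $p$-asymptotically uniformly smoothable if and only if there exists $C>0$ such that $A$ satisfies $C$-$\ell_p$ upper tree estimates.
   Context: For $\sigma>0$ the modulus of asymptotic uniform smoothness of $A$ is $\rho(\sigma,A)=\sup\{\limsup_\lambda\|y+Ax_\lambda\|-1 : y\in B_Y,\ (x_\lambda)\text{ a weakly null net in }\sigma B_X\}$ (and $\rho(\sigma,A)=0$ if $A=0$). For $1<p<\infty$, $A$ is $p$-asymptotically uniformly smooth if $\sup_{\sigma>0}\rho(\sigma,A)/\sigma^p<\infty$; $A$ is asymptotically uniformly flat if $\rho(\sigma,A)=0$ for some $\sigma>0$. $A$ is $p$-asymptotically uniformly smoothable (resp. asymptotically uniformly flattenable) if there is an equivalent norm $|\cdot|$ on $Y$ such that $A:X\to(Y,|\cdot|)$ is $p$-asymptotically uniformly smooth (resp. asymptotically uniformly flat). Upper tree estimates: let $D$ be a neighborhood basis of $0$ in the weak topology of $X$, directed by reverse inclusion ($u\le v$ iff $v\subset u$). A subset $D_0\subset D$ is cofinal if for each $u\in D$ there is $v\in D_0$ with $u\le v$, and eventual if $D\setminus D_0$ is not cofinal. Let $D^n$ be the set of $n$-tuples of elements of $D$, $D^{<\mathbb N}=\bigcup_{n\ge1}D^n$, and for $t=(u_i)_{i=1}^n$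 and $m\le n$ let $t|_m=(u_i)_{i=1}^m$. A set $B\subset D^{<\mathbb N}$ is inevitable if $\{u\in D:(u)\in B\}$ is eventual and for every $(u_i)_{i=1}^n\in B$ the set $\{u\in D:(u_1,\dots,u_n,u)\in B\}$ is eventual; $B$ is big if it contains an inevitable subset. A family $(x_t)_{t\in D^{<\mathbb N}}\subset X$ is normally weakly null if $x_t\in u_n$ whenever $t=(u_i)_{i=1}^n$. For $C>0$ and $1<p<\infty$, $A$ satisfies $C$-$\ell_p$ upper tree estimates if for every normally weakly null $(x_t)_{t\in D^{<\mathbb N}}\subset B_X$ the set $\bigcup_{n}\{t\in D^n: \|A\sum_{i=1}^n a_ix_{t|_i}\|\le C(\sum_{i=1}^n|a_i|^p)^{1/p}\text{ for all }(a_i)_{i=1}^n\in\mathbb K^n\}$ is big. $C$-$c_0$ upper tree estimates are defined the same way with $(\sum|a_i|^p)^{1/p}$ replaced by $\max_i|a_i|$. (These notions do not depend on the choice of $D$.) *)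

(* Defs.v *)
From Stdlib Require Import Reals List ClassicalEpsilon.
Set Implicit Arguments.
Unset Strict Implicit.
Open Scope R_scope.

Inductive kind := KR | KC.

Definition scal (k : kind) : Type :=
  match k with KR => R | KC => (R * R)%type end.

Definition sadd (k : kind) : scal k -> scal k -> scal k :=
  match k return scal k -> scal k -> scal k with
  | KR => Rplus
  | KC => fun a b => (fst a + fst b, snd a + snd b)
  end.
Definition smul (k : kind) : scal k -> scal k -> scal k :=
  match k return scal k -> scal k -> scal k with
  | KR => Rmult
  | KC => fun a b => (fst a * fst b - snd a * snd b, fst a * snd b + snd a * fst b)
  end.
Definition s0 (k : kind) : scal k :=
  match k return scal k with KR => 0 | KC => (0, 0) end.
Definition s1 (k : kind) : scal k :=
  match k return scal k with KR => 1 | KC => (1, 0) end.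
Definition sabs (k : kind) : scal k -> R :=
  match k return scal k -> R with
  | KR => Rabs
  | KC => fun a => sqrt (fst a * fst a + snd a * snd a)
  end.

Arguments sadd : clear implicits.
Arguments smul : clear implicits.
Arguments sabs : clear implicits.

Record VSpace (k : kind) := {
  vcar :> Type;
  vadd : vcar -> vcar -> vcar;
  vzero : vcar;
  vopp : vcar -> vcar;
  vscale : scal k -> vcar -> vcar;
  vadd_assoc : forall x y z, vadd x (vadd y z) = vadd (vadd x y) z;
  vadd_comm : forall x y, vadd x y = vadd y x;
  vadd_0 : forall x, vadd x vzero = x;
  vadd_opp : forall x, vadd x (vopp x) = vzero;
  vscale_1 : forall x, vscale (s1 k) x = x;
  vscale_assoc : forall a b x, vscale a (vscale b x) = vscale (smul k a b) x;
  vscale_distr_v : forall a x y, vscale a (vadd x y) = vadd (vscale a x) (vscale a y);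
  vscale_distr_s : forall a b x, vscale (sadd k a b) x = vadd (vscale a x) (vscale b x)
}.
Arguments vadd {k} _ _ _.
Arguments vzero {k} _.
Arguments vopp {k} _ _.
Arguments vscale {k} _ _ _.

Definition is_norm (k : kind) (V : VSpace k) (n : V -> R) : Prop :=
  (forall x, 0 <= n x) /\
  (forall x, n x = 0 -> x = vzero V) /\
  (forall a x, n (vscale V a x) = sabs k a * n x) /\
  (forall x y, n (vadd V x y) <= n x + n y).

Definition complete (k : kind) (V : VSpace k) (n : V -> R) : Prop :=
  forall u : nat -> V,
    (forall eps, 0 < eps -> exists N, forall m p, (N <= m)%nat -> (N <= p)%nat ->
        n (vadd V (u m) (vopp V (u p))) < eps) ->
    exists l, forall eps, 0 < eps -> exists N, forall m, (N <= m)%nat ->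
        n (vadd V (u m) (vopp V l)) < eps.

Arguments is_norm {k} V n.
Arguments complete {k} V n.

Record Banach (k : kind) := {
  bvs :> VSpace k;
  bnorm : bvs -> R;
  bnorm_ok : is_norm bvs bnorm;
  bcomplete : complete bvs bnorm
}.
Arguments bnorm {k} _ _.

Definition equiv_norm (k : kind) (Y : Banach k) (n : Y -> R) : Prop :=
  is_norm Y n /\
  exists a b, 0 < a /\ 0 < b /\ forall y, a * bnorm Y y <= n y /\ n y <= b * bnorm Y y.

Definition bounded_linear (k : kind) (X Y : Banach k) (A : X -> Y) : Prop :=
  (forall x y, A (vadd X x y) = vadd Y (A x) (A y)) /\
  (forall a x, A (vscale X a x) = vscale Y a (A x)) /\
  exists M, forall x, bnorm Y (A x) <= M * bnorm X x.

Arguments equiv_norm {k} Y n.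
Arguments bounded_linear {k} X Y A.

Definition dual_elt (k : kind) (X : Banach k) (f : X -> scal k) : Prop :=
  (forall x y, f (vadd X x y) = sadd k (f x) (f y)) /\
  (forall a x, f (vscale X a x) = smul k a (f x)) /\
  exists M, forall x, sabs k (f x) <= M * bnorm X x.

Arguments dual_elt {k} X f.

Definition weak_basic (k : kind) (X : Banach k) (fs : list (X -> scal k)) (eps : R)
  : X -> Prop :=
  fun x => forall f, In f fs -> sabs k (f x) < eps.

Arguments weak_basic {k} X fs eps.

Definition is_weak_nbhd (k : kind) (X : Banach k) (U : X -> Prop) : Prop :=
  exists fs eps, (forall f, In f fs -> dual_elt X f) /\ 0 < eps /\ U = weak_basic X fs eps.

Arguments is_weak_nbhd {k} X U.

Definition WD (k : kind) (X : Banach k) : Type := { U : X -> Prop | is_weak_nbhd X U }.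

Definition WD_le (k : kind) (X : Banach k) (u v : WD X) : Prop :=
  forall x, proj1_sig v x -> proj1_sig u x.

Definition cofinal (k : kind) (X : Banach k) (D0 : WD X -> Prop) : Prop :=
  forall u, exists v, D0 v /\ WD_le u v.

Definition eventual (k : kind) (X : Banach k) (D0 : WD X -> Prop) : Prop :=
  ~ cofinal (fun u => ~ D0 u).

(** D^{<N} is modelled by nonempty lists of elements of D; t|_m = firstn m t *)
Definition inevitable (k : kind) (X : Banach k) (B : list (WD X) -> Prop) : Prop :=
  (forall t, B t -> t <> nil) /\
  eventual (fun u => B (u :: nil)) /\
  (forall t, B t -> eventual (fun u => B (t ++ u :: nil))).

Definition big (k : kind) (X : Banach k) (B : list (WD X) -> Prop) : Prop :=
  exists B', (forall t, B' t -> B t) /\ inevitable B'.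

Definition normally_weakly_null (k : kind) (X : Banach k) (x : list (WD X) -> X) : Prop :=
  forall t u, proj1_sig u (x (t ++ u :: nil)).

Definition in_ball_tree (k : kind) (X : Banach k) (x : list (WD X) -> X) : Prop :=
  forall t, t <> nil -> bnorm X (x t) <= 1.

Fixpoint vsum (k : kind) (V : VSpace k) (f : nat -> V) (n : nat) : V :=
  match n with
  | O => vzero V
  | S m => vadd V (vsum f m) (f (S m))
  end.

Arguments vsum {k} V f n.

Fixpoint rsum (f : nat -> R) (n : nat) : R :=
  match n with O => 0 | S m => rsum f m + f (S m) end.

Fixpoint rmax_up (f : nat -> R) (n : nat) : R :=
  match n with O => 0 | S m => Rmax (rmax_up f m) (f (S m)) end.

(** x^q for x >= 0, with 0^q = 0 (q > 0) *)
Definition powr (x q : R) : R := if Rle_dec x 0 then 0 else Rpower x q.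

Definition lp_norm (k : kind) (p : R) (a : nat -> scal k) (n : nat) : R :=
  powr (rsum (fun i => powr (sabs k (a i)) p) n) (/ p).

Definition c0_norm (k : kind) (a : nat -> scal k) (n : nat) : R :=
  rmax_up (fun i => sabs k (a i)) n.

Definition tree_comb (k : kind) (X : Banach k) (x : list (WD X) -> X)
  (a : nat -> scal k) (t : list (WD X)) : X :=
  vsum X (fun i => vscale X (a i) (x (firstn i t))) (length t).

Definition upper_tree_est (k : kind) (X Y : Banach k) (A : X -> Y)
  (nm : (nat -> scal k) -> nat -> R) (C : R) : Prop :=
  forall x : list (WD X) -> X,
    normally_weakly_null x -> in_ball_tree x ->
    big (fun t => t <> nil /\
         forall a : nat -> scal k,
           bnorm Y (A (tree_comb x a t)) <= C * nm a (length t)).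

Definition lp_upper_tree_est (k : kind) (X Y : Banach k) (A : X -> Y) (C p : R) : Prop :=
  upper_tree_est A (lp_norm p) C.

Definition c0_upper_tree_est (k : kind) (X Y : Banach k) (A : X -> Y) (C : R) : Prop :=
  upper_tree_est A (@c0_norm k) C.

Definition directed (L : Type) (le : L -> L -> Prop) : Prop :=
  inhabited L /\ (forall a, le a a) /\
  (forall a b c, le a b -> le b c -> le a c) /\
  (forall a b, exists c, le a c /\ le b c).

Definition weakly_null_net (k : kind) (X : Banach k) (L : Type) (le : L -> L -> Prop)
  (x : L -> X) : Prop :=
  forall f, dual_elt X f -> forall eps, 0 < eps ->
    exists l0, forall l, le l0 l -> sabs k (f (x l)) < eps.

Definition is_glb (E : R -> Prop) (m : R) : Prop :=
  (forall s, E s -> m <= s) /\ (forall m', (forall s, E s -> m' <= s) -> m' <= m).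

Definition is_limsup (L : Type) (le : L -> L -> Prop) (a : L -> R) (v : R) : Prop :=
  is_glb (fun s => exists l0, is_lub (fun r => exists l, le l0 l /\ r = a l) s) v.

Definition rho_set (k : kind) (X Y : Banach k) (nY : Y -> R) (A : X -> Y) (sigma : R)
  : R -> Prop :=
  fun r => exists (y : Y), nY y <= 1 /\
    exists (L : Type) (le : L -> L -> Prop) (x : L -> X),
      directed le /\ weakly_null_net le x /\ (forall l, bnorm X (x l) <= sigma) /\
      exists v, is_limsup le (fun l => nY (vadd Y y (A (x l)))) v /\ r = v - 1.

Definition rho (k : kind) (X Y : Banach k) (nY : Y -> R) (A : X -> Y) (sigma : R) : R :=
  epsilon (inhabits 0) (fun r =>
    ((forall x, A x = vzero Y) /\ r = 0) \/
    ((exists x, A x <> vzero Y) /\ is_lub (rho_set nY A sigma) r)).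

Definition p_AUS (k : kind) (X Y : Banach k) (nY : Y -> R) (A : X -> Y) (p : R) : Prop :=
  exists M, forall sigma, 0 < sigma -> rho nY A sigma / Rpower sigma p <= M.

Definition AUF (k : kind) (X Y : Banach k) (nY : Y -> R) (A : X -> Y) : Prop :=
  exists sigma, 0 < sigma /\ rho nY A sigma = 0.

Definition p_AUS_able (k : kind) (X Y : Banach k) (A : X -> Y) (p : R) : Prop :=
  exists nY, equiv_norm Y nY /\ p_AUS nY A p.

Definition AUF_able (k : kind) (X Y : Banach k) (A : X -> Y) : Prop :=
  exists nY, equiv_norm Y nY /\ AUF nY A.

(* Main.v *)
(** If the tree estimates hold, consider the game in which, from y, the first player
    chooses a weak neighbourhood u of 0, the opponent a vector x of the unit ball in u and
    a scalar a, and y becomes y + a A x; the opponent wins once the norm of y exceeds a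
    budget, which in the l_p case grows by a multiple of |a|^p at each move. A winning
    strategy of the opponent is a well-founded normally weakly null tree, so the tree
    estimate forbids it for small y. The set S of positions not lost therefore contains a
    ball, is bounded, and for s in S the vectors s + a A x with |a| <= sigma lie in kappa
    S for x in the unit ball and in some weak neighbourhood, where kappa = (1 + D
    sigma^p)^(1/p) (respectively kappa = 1 for sigma = 1). The property passes to the
    absolutely convex hull of S, and its gauge is the new norm.

    Conversely, a smooth norm n controls n (y + b A x) by H (n y) |b| up to epsilon, for x
    in a weak neighbourhood depending on y. By compactness this is uniform over all y = A
    sum a_i x_i with bounded coefficients, so the constants of the tree estimate can be
    kept along a branch up to increments which sum to at most 1. *)

Require Import Defs.
From Stdlib Require Import Reals Lra Lia List ClassicalEpsilon Classical.
Open Scope R_scope.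

(** * Scalars *)

Definition of_R (k : kind) : R -> scal k :=
  match k return R -> scal k with KR => fun r => r | KC => fun r => (r, 0) end.

Definition sinv (k : kind) : scal k -> scal k :=
  match k return scal k -> scal k with
  | KR => Rinv
  | KC => fun a => let d := fst a * fst a + snd a * snd a in (fst a / d, - snd a / d)
  end.

Lemma smul_comm k (a b : scal k) : smul k a b = smul k b a.
Proof. destruct k; simpl in *; [ring | f_equal; ring]. Qed.

Lemma smul_assoc k (a b c : scal k) : smul k a (smul k b c) = smul k (smul k a b) c.
Proof. destruct k; simpl in *; [ring | f_equal; ring]. Qed.

Lemma smul_sadd_l k (a b c : scal k) :
  smul k (sadd k a b) c = sadd k (smul k a c) (smul k b c).
Proof. destruct k; simpl in *; [ring | f_equal; ring]. Qed.

Lemma smul_1_l k (a : scal k) : smul k (s1 k) a = a.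
Proof. destruct k; simpl in *; [ring | destruct a; simpl; f_equal; ring]. Qed.

Lemma sadd_0_l k (a : scal k) : sadd k (s0 k) a = a.
Proof. destruct k; simpl in *; [ring | destruct a; simpl; f_equal; ring]. Qed.

Lemma of_R_1 k : of_R k 1 = s1 k.
Proof. now destruct k. Qed.

Lemma of_R_0 k : of_R k 0 = s0 k.
Proof. now destruct k. Qed.

Lemma of_R_mul k r s : of_R k (r * s) = smul k (of_R k r) (of_R k s).
Proof. destruct k; simpl; [ring | f_equal; ring]. Qed.

Lemma of_R_add k r s : of_R k (r + s) = sadd k (of_R k r) (of_R k s).
Proof. destruct k; simpl; [ring | f_equal; ring]. Qed.

Lemma sabs_ge0 k (a : scal k) : 0 <= sabs k a.
Proof. destruct k; simpl; [apply Rabs_pos | apply sqrt_pos]. Qed.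

Lemma sabs_of_R k r : sabs k (of_R k r) = Rabs r.
Proof.
  destruct k; simpl; [reflexivity|].
  replace (r * r + 0 * 0) with (Rsqr r) by (unfold Rsqr; ring).
  apply sqrt_Rsqr_abs.
Qed.

Lemma sabs_of_R_pos k r : 0 <= r -> sabs k (of_R k r) = r.
Proof. intros; rewrite sabs_of_R; now apply Rabs_pos_eq. Qed.

Lemma sabs_s1 k : sabs k (s1 k) = 1.
Proof. rewrite <- of_R_1, sabs_of_R_pos; lra. Qed.

Lemma sabs_s0 k : sabs k (s0 k) = 0.
Proof. rewrite <- of_R_0, sabs_of_R_pos; lra. Qed.

Lemma sabs_mul k (a b : scal k) : sabs k (smul k a b) = sabs k a * sabs k b.
Proof.
  destruct k; simpl in *; [apply Rabs_mult|].
  rewrite <- sqrt_mult_alt by nra. f_equal; ring.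
Qed.

Lemma sabs_eq0 k (a : scal k) : sabs k a = 0 -> a = s0 k.
Proof.
  destruct k; simpl in *; intros H.
  - destruct (Req_dec a 0); [easy|]. now apply Rabs_no_R0 in H.
  - apply sqrt_eq_0 in H; [|nra]. destruct a as [x y]; simpl in *.
    f_equal; nra.
Qed.

Lemma smul_sinv k (a : scal k) : sabs k a <> 0 -> smul k a (sinv k a) = s1 k.
Proof.
  destruct k; simpl in *; intros H.
  - apply Rinv_r. intros ->; apply H, Rabs_R0.
  - assert (fst a * fst a + snd a * snd a <> 0) by (intros E; apply H; rewrite E; apply sqrt_0).
    f_equal; field; auto.
Qed.

Lemma sabs_sinv k (a : scal k) : sabs k a <> 0 -> sabs k (sinv k a) = / sabs k a.
Proof.
  intros H. pose proof (f_equal (sabs k) (smul_sinv k a H)) as E.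
  rewrite sabs_mul, sabs_s1 in E. field_simplify_eq; [lra | auto].
Qed.

(** * Normed spaces *)

Lemma vadd_0_l k (V : VSpace k) (x : V) : vadd V (vzero V) x = x.
Proof. rewrite vadd_comm; apply vadd_0. Qed.

Lemma vadd_cancel k (V : VSpace k) (x y z : V) : vadd V x y = vadd V x z -> y = z.
Proof.
  intros H. apply (f_equal (vadd V (vopp V x))) in H.
  now rewrite !vadd_assoc, (vadd_comm (vopp V x) x), vadd_opp, !vadd_0_l in H.
Qed.

Lemma vscale_0_l k (V : VSpace k) (x : V) : vscale V (s0 k) x = vzero V.
Proof.
  apply (vadd_cancel k V (vscale V (s0 k) x)).
  now rewrite <- vscale_distr_s, sadd_0_l, vadd_0.
Qed.

Lemma vscale_0_r k (V : VSpace k) (a : scal k) : vscale V a (vzero V) = vzero V.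
Proof.
  apply (vadd_cancel k V (vscale V a (vzero V))).
  now rewrite <- vscale_distr_v, !vadd_0.
Qed.

Lemma vopp_scale k (V : VSpace k) (x : V) : vopp V x = vscale V (of_R k (-1)) x.
Proof.
  apply (vadd_cancel k V x). rewrite vadd_opp.
  rewrite <- (vscale_1 x) at 1. rewrite <- vscale_distr_s, <- of_R_1, <- of_R_add.
  replace (1 + -1) with 0 by ring. now rewrite of_R_0, vscale_0_l.
Qed.

Lemma vadd_swap k (V : VSpace k) (a b c d : V) :
  vadd V (vadd V a b) (vadd V c d) = vadd V (vadd V a c) (vadd V b d).
Proof.
  rewrite <- !vadd_assoc. f_equal. rewrite !vadd_assoc. f_equal. apply vadd_comm.
Qed.

Lemma vsum_scale k (V : VSpace k) c (f : nat -> V) n :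
  vsum V (fun i => vscale V c (f i)) n = vscale V c (vsum V f n).
Proof.
  induction n; simpl; [now rewrite vscale_0_r | now rewrite IHn, vscale_distr_v].
Qed.

Lemma vsum_ext k (V : VSpace k) (f g : nat -> V) n :
  (forall i, (1 <= i <= n)%nat -> f i = g i) -> vsum V f n = vsum V g n.
Proof.
  induction n; simpl; intros H; [easy|].
  rewrite IHn, H; [easy | lia | intros; apply H; lia].
Qed.

Lemma vsum_shift k (V : VSpace k) (f : nat -> V) n :
  vsum V f (S n) = vadd V (f 1%nat) (vsum V (fun i => f (S i)) n).
Proof.
  induction n; [simpl; now rewrite vadd_0, vadd_0_l|].
  change (vsum V f (S (S n))) with (vadd V (vsum V f (S n)) (f (S (S n)))).
  rewrite IHn. simpl. now rewrite vadd_assoc.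
Qed.

Lemma rsum_shift (f : nat -> R) n : rsum f (S n) = f 1%nat + rsum (fun i => f (S i)) n.
Proof.
  induction n; [simpl; ring|].
  change (rsum f (S (S n))) with (rsum f (S n) + f (S (S n))). rewrite IHn; simpl; ring.
Qed.

Lemma rsum_ext (f g : nat -> R) n :
  (forall i, (1 <= i <= n)%nat -> f i = g i) -> rsum f n = rsum g n.
Proof.
  induction n; simpl; intros H; [easy|].
  rewrite IHn, H; [easy | lia | intros; apply H; lia].
Qed.

Lemma rsum_scale c (f : nat -> R) n : rsum (fun i => c * f i) n = c * rsum f n.
Proof. induction n; simpl; [ring | rewrite IHn; ring]. Qed.

Lemma rsum_ge0 (f : nat -> R) n : (forall i, 0 <= f i) -> 0 <= rsum f n.
Proof. intros H; induction n; simpl; [lra | specialize (H (S n)); lra]. Qed.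

Section Norm.
Context {k : kind} {V : VSpace k} (n : V -> R) (Hn : is_norm V n).

Lemma norm_ge0 x : 0 <= n x. Proof. apply Hn. Qed.
Lemma norm_scale a x : n (vscale V a x) = sabs k a * n x. Proof. apply Hn. Qed.
Lemma norm_add x y : n (vadd V x y) <= n x + n y. Proof. apply Hn. Qed.
Lemma norm_eq0 x : n x = 0 -> x = vzero V. Proof. apply Hn. Qed.

Lemma norm_0 : n (vzero V) = 0.
Proof. rewrite <- (vscale_0_l k V (vzero V)), norm_scale, sabs_s0; ring. Qed.

Lemma norm_opp x : n (vopp V x) = n x.
Proof. rewrite vopp_scale, norm_scale, sabs_of_R, Rabs_left by lra; ring. Qed.

Lemma norm_sub_le x y : n x <= n y + n (vadd V x (vopp V y)).
Proof.
  replace (n x) with (n (vadd V y (vadd V x (vopp V y)))); [apply norm_add|].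
  now rewrite (vadd_comm x), vadd_assoc, vadd_opp, vadd_0_l.
Qed.

Lemma norm_scale_R r x : 0 <= r -> n (vscale V (of_R k r) x) = r * n x.
Proof. intros; now rewrite norm_scale, sabs_of_R_pos. Qed.
End Norm.

(** * Powers of nonnegative reals *)

Lemma powr_pos_eq x q : 0 < x -> powr x q = Rpower x q.
Proof. intros; unfold powr; destruct (Rle_dec x 0); [lra | easy]. Qed.

Lemma powr_0 q : powr 0 q = 0.
Proof. unfold powr; destruct (Rle_dec 0 0); lra. Qed.

Lemma powr_pos x q : 0 < x -> 0 < powr x q.
Proof. intros; rewrite powr_pos_eq by easy; apply exp_pos. Qed.

Lemma powr_ge0 x q : 0 <= powr x q.
Proof. unfold powr; destruct (Rle_dec x 0); [lra | apply Rlt_le, exp_pos]. Qed.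

Lemma powr_1_l q : powr 1 q = 1.
Proof. rewrite powr_pos_eq by lra. unfold Rpower. rewrite ln_1, Rmult_0_r; apply exp_0. Qed.

Lemma powr_mono q x y : 0 < q -> 0 <= x <= y -> powr x q <= powr y q.
Proof.
  intros Hq [[Hx|<-] Hy]; [|rewrite powr_0; apply powr_ge0].
  rewrite !powr_pos_eq by lra. apply Rle_Rpower_l; lra.
Qed.

Lemma powr_mult q x y : 0 <= x -> 0 <= y -> powr (x * y) q = powr x q * powr y q.
Proof.
  intros [Hx|<-] [Hy|<-]; rewrite ?Rmult_0_l, ?Rmult_0_r, ?powr_0; try ring.
  rewrite !powr_pos_eq by (try apply Rmult_lt_0_compat; lra).
  now rewrite Rpower_mult_distr.
Qed.

Lemma powr_inv q x : q <> 0 -> 0 <= x -> powr (powr x q) (/ q) = x.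
Proof.
  intros Hq [Hx|<-]; [|now rewrite !powr_0].
  rewrite (powr_pos_eq (powr x q)), (powr_pos_eq x) by auto using powr_pos.
  rewrite Rpower_mult, Rinv_r, Rpower_1; auto.
Qed.

Lemma powr_inv' q x : q <> 0 -> 0 <= x -> powr (powr x (/ q)) q = x.
Proof.
  intros Hq Hx. rewrite <- (Rinv_inv q) at 2. apply powr_inv; auto using Rinv_neq_0_compat.
Qed.

Lemma powr_le_inv q x y : 0 < q -> 0 <= x -> 0 <= y -> powr x q <= powr y q -> x <= y.
Proof.
  intros Hq Hx Hy H. rewrite <- (powr_inv q x), <- (powr_inv q y) by lra.
  apply powr_mono; [now apply Rinv_0_lt_compat|]. split; auto using powr_ge0.
Qed.

Lemma powr_lt q x y : 0 < q -> 0 <= x < y -> powr x q < powr y q.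
Proof.
  intros Hq H. destruct (Rlt_le_dec (powr x q) (powr y q)) as [|H']; [easy|].
  apply powr_le_inv in H'; lra.
Qed.

(** From x + y <= 2 max(x, y). The factor 2^q is paid for in the l_p game by starting in the ball of
    radius 1/2 and by the price constant (2C)^p. *)
Lemma powr_add_le q x y : 0 < q -> 0 <= x -> 0 <= y ->
  powr (x + y) q <= powr 2 q * (powr x q + powr y q).
Proof.
  intros Hq Hx Hy. pose proof (powr_ge0 x q); pose proof (powr_ge0 y q).
  pose proof (powr_ge0 2 q).
  destruct (Rle_dec x y).
  - apply Rle_trans with (powr (2 * y) q); [apply powr_mono; lra|].
    rewrite powr_mult by lra. nra.
  - apply Rle_trans with (powr (2 * x) q); [apply powr_mono; lra|].
    rewrite powr_mult by lra. nra.
Qed.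

Lemma continuity_pt_powr q x : 0 < q -> 0 <= x -> continuity_pt (fun t => powr t q) x.
Proof.
  intros Hq [Hx|<-].
  - apply (continuity_pt_locally_ext (fun t => Rpower t q) _ x); [easy| |].
    + intros y Hy. unfold Rdist in Hy. apply Rabs_def2 in Hy. rewrite powr_pos_eq; [easy|lra].
    + apply derivable_continuous_pt. exists (q * Rpower x (q - 1)).
      now apply derivable_pt_lim_power.
  - intros eps Heps. exists (powr eps (/ q)). split; [now apply powr_pos|].
    intros t [_ Ht]. simpl in *. unfold Rdist in *. rewrite powr_0, Rminus_0_r in *.
    rewrite (Rabs_pos_eq (powr t q)) by apply powr_ge0.
    rewrite <- (powr_inv' q eps) by lra.
    unfold powr at 1. destruct (Rle_dec t 0) as [H|H]; [now apply powr_pos, powr_pos|].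
    rewrite <- powr_pos_eq by lra. apply powr_lt; [easy|].
    rewrite Rabs_pos_eq in Ht; lra.
Qed.

(** Heine's theorem on [0, M + 1]. The bound is one-sided, so t may lie far below s, where
    monotonicity suffices. *)
Lemma powr_unif_cont q M eps : 0 < q -> 0 < eps -> exists delta, 0 < delta /\
  forall s t, 0 <= s <= M -> 0 <= t <= s + delta -> powr t q <= powr s q + eps.
Proof.
  intros Hq Heps.
  destruct (Heine (fun t => powr t q) (fun t => 0 <= t <= M + 1) (compact_P3 0 (M + 1)))
    with (eps := mkposreal eps Heps) as [[d Hd] H].
  { intros; apply continuity_pt_powr; lra. }
  simpl in H. exists (Rmin (d / 2) 1). split; [apply Rmin_pos; lra|].
  intros s t Hs Ht. pose proof (Rmin_l (d / 2) 1); pose proof (Rmin_r (d / 2) 1).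
  destruct (Rle_lt_dec t s) as [Hts|Hts].
  - pose proof (powr_mono q t s); lra.
  - assert (Rabs (powr t q - powr s q) < eps) as E.
    { apply H; try lra. apply Rabs_def1; lra. }
    apply Rabs_def2 in E; lra.
Qed.

(** Since 1 + u >= 1 and q > 1, 1 + u <= (1 + u)^q. This turns kappa = (1 + D sigma^p)^(1/p) into
    kappa - 1 <= D sigma^p. *)
Lemma powr_inv_le q u : 1 < q -> 0 <= u -> powr (1 + u) (/ q) <= 1 + u.
Proof.
  intros Hq Hu. apply (powr_le_inv q); try lra; [apply powr_ge0|].
  rewrite powr_inv', powr_pos_eq by lra.
  rewrite <- (Rpower_1 (1 + u)) at 1 by lra. apply Rle_Rpower; lra.
Qed.

(** With v = q M u, (1 + M u)^q <= e^v and e^v - 1 <= v e^v, while v <= q M because u <= 1. *)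
Lemma powr_1_add_le q M u : 0 < q -> 0 <= M -> 0 <= u <= 1 ->
  powr (1 + M * u) q <= 1 + q * M * exp (q * M) * u.
Proof.
  intros Hq HM Hu. rewrite powr_pos_eq by nra.
  set (v := q * (M * u)).
  assert (H1 : Rpower (1 + M * u) q <= exp v).
  { replace (exp v) with (Rpower (exp (M * u)) q) by (unfold Rpower; now rewrite ln_exp).
    apply Rle_Rpower_l; [lra|]. split; [nra | apply exp_ineq1_le]. }
  assert (H2 : exp v <= exp (q * M)).
  { assert (Hv : v <= q * M) by (unfold v; apply Rmult_le_compat_l; nra).
    destruct Hv as [Hv|Hv]; [now apply Rlt_le, exp_increasing | rewrite Hv; lra]. }
  assert (H3 : 1 + - v <= exp (- v)) by apply exp_ineq1_le.
  assert (H4 : exp v * exp (- v) = 1) by (rewrite <- exp_plus, Rplus_opp_r; apply exp_0).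
  assert (0 <= v) by (unfold v; apply Rmult_le_pos; nra).
  assert (0 < exp v) by apply exp_pos.
  replace (q * M * exp (q * M) * u) with (v * exp (q * M)) by (unfold v; ring).
  nra.
Qed.

(** * Weak neighbourhoods and upper limits *)

Lemma glb_exists (E : R -> Prop) m : (exists t, E t) -> (forall t, E t -> m <= t) ->
  exists v, is_glb E v.
Proof.
  intros [t Ht] Hm.
  destruct (completeness (fun s => E (- s))) as [v [H1 H2]].
  - exists (- m). intros s Hs. apply Hm in Hs. lra.
  - exists (- t). now rewrite Ropp_involutive.
  - exists (- v). split.
    + intros s Hs. rewrite <- (Ropp_involutive s) in Hs. apply H1 in Hs. lra.
    + intros m' Hm'. apply Ropp_le_cancel. rewrite Ropp_involutive. apply H2.
      intros s Hs. apply Hm' in Hs. lra.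
Qed.

Section Limsup.
Context {L : Type} (le : L -> L -> Prop) (Hdir : directed le) (f : L -> R).

Lemma limsup_exists m M : (forall l, m <= f l <= M) -> exists v, is_limsup le f v.
Proof.
  intros Hf. destruct Hdir as [[l0] [Hrefl _]].
  assert (Hlub : exists s, is_lub (fun r => exists l, le l0 l /\ r = f l) s).
  { destruct (completeness (fun r => exists l, le l0 l /\ r = f l)) as [s Hs].
    - exists M. intros r [l [_ ->]]. apply Hf.
    - exists (f l0), l0. auto.
    - now exists s. }
  apply (glb_exists _ m).
  - destruct Hlub as [s Hs]. now exists s, l0.
  - intros s [l1 [Hs _]]. apply Rle_trans with (f l1); [apply Hf|].
    apply Hs. exists l1. auto.
Qed.

Lemma limsup_le v c : is_limsup le f v -> (exists l0, forall l, le l0 l -> f l <= c) -> v <= c.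
Proof.
  intros [Hv _] [l0 Hl0]. destruct Hdir as [_ [Hrefl _]].
  destruct (completeness (fun r => exists l, le l0 l /\ r = f l)) as [s Hs].
  - exists c. intros r [l [Hl ->]]. auto.
  - exists (f l0), l0. auto.
  - apply Rle_trans with s; [apply Hv; now exists l0|].
    apply Hs. intros r [l [Hl ->]]. auto.
Qed.

Lemma limsup_ge v c : is_limsup le f v -> (forall l, c <= f l) -> c <= v.
Proof.
  intros [_ Hv] Hf. destruct Hdir as [_ [Hrefl _]].
  apply Hv. intros s [l0 [Hs _]].
  apply Rle_trans with (f l0); [apply Hf|]. apply Hs. exists l0. auto.
Qed.
End Limsup.

Section WeakNbhd.
Context {k : kind} {X : Banach k}.

Lemma WD_inhabited : exists u : WD X, True.
Proof.
  unshelve eexists; [|trivial]. exists (weak_basic X nil 1), nil, 1.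
  split; [intros f []|]. split; [lra | easy].
Qed.

Lemma WD_inter (u v : WD X) : exists w, WD_le u w /\ WD_le v w.
Proof.
  destruct u as [U [fs [e [Hfs [He EU]]]]], v as [V [gs [d [Hgs [Hd EV]]]]].
  assert (is_weak_nbhd X (weak_basic X (fs ++ gs) (Rmin e d))) as Hw.
  { exists (fs ++ gs), (Rmin e d). split; [|split; [now apply Rmin_pos | easy]].
    intros f Hf. apply in_app_or in Hf. destruct Hf; auto. }
  exists (exist _ _ Hw). unfold WD_le; simpl. subst U V.
  split; intros x Hx f Hf; specialize (Hx f); rewrite in_app_iff in Hx;
    pose proof (Rmin_l e d); pose proof (Rmin_r e d); specialize (Hx ltac:(auto)); lra.
Qed.

Lemma WD_scale (u : WD X) tau : 0 <= tau ->
  exists w : WD X, forall x, proj1_sig w x ->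
    forall b, sabs k b <= tau -> proj1_sig u (vscale X b x).
Proof.
  intros Ht. destruct u as [U [fs [e [Hfs [He EU]]]]].
  (* The divisor 1 + tau stays positive at tau = 0. *)
  assert (0 < e / (1 + tau)) as Hp by (apply Rdiv_lt_0_compat; lra).
  assert (is_weak_nbhd X (weak_basic X fs (e / (1 + tau)))) as Hw.
  { exists fs, (e / (1 + tau)). auto. }
  exists (exist _ _ Hw). simpl. subst U. intros x Hx b Hb f Hf.
  rewrite (proj1 (proj2 (Hfs f Hf))), sabs_mul.
  specialize (Hx f Hf). pose proof (sabs_ge0 k b). pose proof (sabs_ge0 k (f x)).
  apply Rle_lt_trans with (tau * sabs k (f x)); [nra|].
  apply Rle_lt_trans with ((1 + tau) * sabs k (f x)); [nra|].
  apply Rlt_le_trans with ((1 + tau) * (e / (1 + tau))); [nra|].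
  right; field; lra.
Qed.

Lemma WD_directed : directed (@WD_le k X).
Proof.
  destruct WD_inhabited as [u _].
  split; [now constructor|]. split; [intros a x; auto|].
  split; [intros a b c H1 H2 x Hx; auto | apply WD_inter].
Qed.

Context {L : Type} (le : L -> L -> Prop) (Hdir : directed le).

Lemma weakly_null_eventually (x : L -> X) (u : WD X) : weakly_null_net le x ->
  exists l0, forall l, le l0 l -> proj1_sig u (x l).
Proof.
  intros Hx. destruct u as [U [fs [e [Hfs [He ->]]]]]. simpl.
  destruct Hdir as [[i0] [_ [Htrans Hup]]].
  induction fs as [|f fs IH].
  - exists i0. intros l _ f [].
  - destruct IH as [l1 H1]; [intros g Hg; apply Hfs; now right|].
    destruct (Hx f (Hfs f (or_introl eq_refl)) e He) as [l2 H2].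
    destruct (Hup l1 l2) as [l3 [H31 H32]]. exists l3.
    intros l Hl g [<-|Hg]; [|apply H1; eauto]. eauto.
Qed.

Lemma weakly_null_scale (x : L -> X) c : weakly_null_net le x ->
  weakly_null_net le (fun l => vscale X c (x l)).
Proof.
  intros Hx f Hf e He. pose proof (sabs_ge0 k c).
  destruct (Hx f Hf (e / (1 + sabs k c))) as [l0 H0]; [apply Rdiv_lt_0_compat; lra|].
  exists l0. intros l Hl. rewrite (proj1 (proj2 Hf)), sabs_mul.
  specialize (H0 l Hl). pose proof (sabs_ge0 k (f (x l))).
  apply Rle_lt_trans with ((1 + sabs k c) * sabs k (f (x l))); [nra|].
  apply Rlt_le_trans with ((1 + sabs k c) * (e / (1 + sabs k c))); [nra|].
  right; field; lra.
Qed.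
End WeakNbhd.

(** Passage from neighbourhoods to nets: vectors picked one in each u form a net indexed by the
    neighbourhood basis itself. *)
Lemma WD_net_weakly_null k (X : Banach k) (x : WD X -> X) :
  (forall u, proj1_sig u (x u)) -> weakly_null_net (@WD_le k X) x.
Proof.
  intros Hx f Hf e He.
  assert (is_weak_nbhd X (weak_basic X (f :: nil) e)) as Hw.
  { exists (f :: nil), e. split; [intros g [<-|[]]; easy | auto]. }
  exists (exist _ _ Hw). intros u Hu. apply (Hu _ (Hx u)). now left.
Qed.

Lemma eventual_intro k (X : Banach k) (D0 : WD X -> Prop) :
  (exists u, forall v, WD_le u v -> D0 v) -> eventual D0.
Proof. intros [u Hu] Hc. destruct (Hc u) as [v [H1 H2]]. auto. Qed.

Lemma eventual_nonempty k (X : Banach k) (D0 : WD X -> Prop) :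
  eventual D0 -> exists u, D0 u.
Proof.
  intros H. apply NNPP. intros Hn. apply H. intros u. exists u.
  split; [intros Hu; apply Hn; now exists u | intros x; auto].
Qed.

(** * The modulus of asymptotic uniform smoothness *)

Section Rho.
Context {k : kind} {X Y : Banach k} {A : X -> Y} (hA : bounded_linear X Y A).

Lemma A_add x y : A (vadd X x y) = vadd Y (A x) (A y). Proof. apply hA. Qed.
Lemma A_scale a x : A (vscale X a x) = vscale Y a (A x). Proof. apply hA. Qed.

Lemma A_0 : A (vzero X) = vzero Y.
Proof. now rewrite <- (vscale_0_l k X (vzero X)), A_scale, vscale_0_l. Qed.

Lemma equiv_norm_bound nY : equiv_norm Y nY ->
  exists Lip, 0 < Lip /\ forall x, nY (A x) <= Lip * bnorm X x.
Proof.
  intros [_ [a [b [Ha [Hb Hab]]]]]. destruct hA as [_ [_ [M HM]]].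
  exists (b * (Rabs M + 1)). pose proof (Rabs_pos M). split; [nra|].
  intros x. apply Rle_trans with (b * bnorm Y (A x)); [apply Hab|].
  rewrite Rmult_assoc. apply Rmult_le_compat_l; [lra|].
  apply Rle_trans with (M * bnorm X x); [apply HM|].
  pose proof (norm_ge0 _ (bnorm_ok X) x). pose proof (Rle_abs M). nra.
Qed.

Lemma rho_zero nY sigma : (forall x, A x = vzero Y) -> rho nY A sigma = 0.
Proof.
  intros H. unfold rho.
  match goal with |- epsilon ?i ?P = 0 => pose proof (epsilon_spec i P) as [[_ E]|[[x Hx] _]] end.
  - exists 0. auto.
  - exact E.
  - now destruct (Hx (H x)).
Qed.

(** Realised by the constant net 0. With y = 0 it makes the set nonempty; with y of norm 1 it makes
    the modulus nonnegative. *)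
Lemma rho_set_const nY sigma y : 0 <= sigma -> nY y <= 1 -> rho_set nY A sigma (nY y - 1).
Proof.
  intros Hs Hy. exists y. split; [easy|].
  exists unit, (fun _ _ => True), (fun _ => vzero X).
  split; [repeat split; auto; intros; now exists tt|].
  split.
  { intros f Hf e He. exists tt. intros _ _.
    rewrite <- (vscale_0_l k X (vzero X)), (proj1 (proj2 Hf)), sabs_mul, sabs_s0. lra. }
  split; [intros _; now rewrite (norm_0 _ (bnorm_ok X))|].
  exists (nY y). split; [|easy]. rewrite A_0, vadd_0.
  assert (forall s, is_lub (fun r => exists l : unit, True /\ r = nY y) s <-> s = nY y) as E.
  { intros s. split.
    - intros [H1 H2]. apply Rle_antisym; [apply H2; intros r [_ [_ ->]]; lra|].
      apply H1. now exists tt.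
    - intros ->. split; [intros r [_ [_ ->]]; lra|]. intros b Hb. apply Hb. now exists tt. }
  split.
  - intros s [_ Hs']. apply E in Hs'. lra.
  - intros m Hm. apply Hm. exists tt. now apply E.
Qed.

(** The set is bounded by K sigma, with K a bound of A for nY; hence its supremum exists and is what
    [epsilon] selects. *)
Lemma rho_spec nY sigma : equiv_norm Y nY -> 0 <= sigma ->
  (exists x, A x <> vzero Y) -> is_lub (rho_set nY A sigma) (rho nY A sigma).
Proof.
  intros HY Hs HA.
  destruct (equiv_norm_bound nY HY) as [K [HK HKx]].
  destruct (completeness (rho_set nY A sigma)) as [v Hv].
  - exists (K * sigma). intros r [y [Hy [L [le [x [Hdir [Hx [Hxs [v [Hv ->]]]]]]]]]].
    enough (v <= 1 + K * sigma) by lra.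
    apply (limsup_le le Hdir _ _ _ Hv). destruct Hdir as [[l0] _]. exists l0. intros l _.
    eapply Rle_trans; [apply (norm_add _ (proj1 HY))|].
    specialize (HKx (x l)); specialize (Hxs l). nra.
  - exists (nY (vzero Y) - 1). apply rho_set_const; [easy|].
    rewrite (norm_0 _ (proj1 HY)). lra.
  - unfold rho.
    match goal with |- is_lub _ (epsilon ?i ?P) =>
      pose proof (epsilon_spec i P) as [[H0 _]|[_ E]] end.
    + exists v. auto.
    + destruct HA as [x Hx]. now destruct (Hx (H0 x)).
    + exact E.
Qed.
End Rho.

(** * The renorming game *)

Section Game.
Context {k : kind} {X Y : Banach k} {A : X -> Y} (hA : bounded_linear X Y A).
(** The opponent may use the scalars in [allowed], a move with a raises the budget by [w a], and
    [phi] of the norm is compared with the budget. For c_0: phi t = t, |a| <= 1, w = 0. For l_p: phi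
    t = t^p, every scalar, w a = D |a|^p. *)
Context (phi : R -> R) (allowed : scal k -> Prop) (w : scal k -> R).

(* The opponent wins from y with budget r: in finitely many moves, but with no uniform bound on
   their number, so the winning tree may have infinite rank. *)
Inductive Bad : Y -> R -> Prop :=
| Bad_now y r : r < phi (bnorm Y y) -> Bad y r
| Bad_step y r (x : WD X -> X) (a : WD X -> scal k) :
    (forall u, proj1_sig u (x u)) -> (forall u, bnorm X (x u) <= 1) ->
    (forall u, allowed (a u)) ->
    (forall u, Bad (vadd Y y (vscale Y (a u) (A (x u)))) (r + w (a u))) -> Bad y r.

Lemma Bad_mono y r r' : Bad y r -> r' <= r -> Bad y r'.
Proof.
  intros H. revert r'. induction H as [y r H | y r x a Hu Hx Ha _ IH]; intros r' Hr.
  - apply Bad_now; lra.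
  - apply (Bad_step y r' x a); auto. intros u. apply IH. lra.
Qed.

(** Homogeneity of the game: from c y the opponent replays the same vectors with scalars multiplied
    by c. In the l_p game d = c^p. *)
Lemma Bad_scale c d : 0 <= c -> 0 < d -> (forall t, 0 <= t -> phi (c * t) = d * phi t) ->
  (forall a, allowed a -> allowed (smul k (of_R k c) a)) ->
  (forall a, w (smul k (of_R k c) a) = d * w a) ->
  forall y r, Bad y r -> Bad (vscale Y (of_R k c) y) (d * r).
Proof.
  intros Hc Hd Hphi Hal Hw y r H.
  induction H as [y r H | y r x a Hu Hx Ha _ IH].
  - apply Bad_now. rewrite (norm_scale_R _ (bnorm_ok Y)), Hphi by
      (easy || apply (norm_ge0 _ (bnorm_ok Y))). nra.
  - apply (Bad_step _ _ x (fun u => smul k (of_R k c) (a u))); auto.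
    intros u. specialize (IH u).
    now rewrite vscale_distr_v, vscale_assoc, Rmult_plus_distr_l, <- Hw in IH.
Qed.

(** If every u contained an offending pair x, a, choosing one for each u would be a winning first
    move of the opponent. *)
Lemma not_Bad_step y r : ~ Bad y r -> exists u : WD X, forall x, proj1_sig u x ->
  bnorm X x <= 1 -> forall a, allowed a -> ~ Bad (vadd Y y (vscale Y a (A x))) (r + w a).
Proof.
  intros Hg. apply NNPP. intros Hn. apply Hg.
  assert (forall u : WD X, exists xa : X * scal k, proj1_sig u (fst xa) /\
    bnorm X (fst xa) <= 1 /\ allowed (snd xa) /\
    Bad (vadd Y y (vscale Y (snd xa) (A (fst xa)))) (r + w (snd xa))) as H.
  { intros u. apply NNPP. intros Hu. apply Hn. exists u. intros x Hx H1 a Ha Hb.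
    apply Hu. exists (x, a). auto. }
  pose (f := fun u => proj1_sig (constructive_indefinite_description _ (H u))).
  pose proof (fun u => proj2_sig (constructive_indefinite_description _ (H u))) as Hf.
  apply (Bad_step y r (fun u => fst (f u)) (fun u => snd (f u))); intros u; apply (Hf u).
Qed.

(** The tree with first level x0 and with T u above the node (u). The empty list is not a node, so
    its value is a placeholder. *)
Definition graft (x0 : WD X -> X) (T : WD X -> list (WD X) -> X) (t : list (WD X)) : X :=
  match t with
  | nil => vzero X
  | u :: nil => x0 u
  | u :: t' => T u t'
  end.

(** Coefficients are indexed from 1: c is the first one, and a is shifted by one place. *)
Lemma tree_comb_graft x0 T c a u t :
  tree_comb (graft x0 T) (fun i => match i with S (S j) => a (S j) | _ => c end) (u :: t) =
  vadd X (vscale X c (x0 u)) (tree_comb (T u) a t).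
Proof.
  unfold tree_comb. simpl length. rewrite vsum_shift. simpl firstn at 1. f_equal.
  apply vsum_ext. intros [|i] Hi; [lia|].
  destruct t as [|v t]; [simpl in Hi; lia | easy].
Qed.

(** A winning strategy is turned into a tree of vectors, by induction on its derivation. Every
    inevitable B follows the strategy along some branch until the budget is exceeded; t = nil stands
    for a position already won. *)
Lemma Bad_tree y r : Bad y r -> exists x : list (WD X) -> X,
  normally_weakly_null x /\ in_ball_tree x /\
  forall B, inevitable B -> exists t a, (t = nil \/ B t) /\
    (forall i, (1 <= i <= length t)%nat -> allowed (a i)) /\
    r + rsum (fun i => w (a i)) (length t) <
      phi (bnorm Y (vadd Y y (A (tree_comb x a t)))).
Proof.
  intros H. induction H as [y r H | y r x a Hu Hx Ha _ IH].
  (* Already won: the zero tree is normally weakly null and the empty branch is the witness. *)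
  - assert (forall u : WD X, proj1_sig u (vzero X)) as H0.
    { intros [U [fs [e [Hfs [He ->]]]]] f Hf. simpl.
      rewrite <- (vscale_0_l k X (vzero X)), (proj1 (proj2 (Hfs f Hf))), sabs_mul, sabs_s0.
      lra. }
    exists (fun _ => vzero X). split; [intros t u; auto|].
    split; [intros t _; rewrite (norm_0 _ (bnorm_ok X)); lra|].
    intros B _. exists nil, (fun _ => s0 k). split; [auto|].
    split; [simpl; lia|]. simpl. unfold tree_comb; simpl.
    rewrite (A_0 hA), vadd_0. lra.
  - pose (T := fun u => proj1_sig (constructive_indefinite_description _ (IH u))).
    pose proof (fun u => proj2_sig (constructive_indefinite_description _ (IH u))) as HT.
    fold T in HT. change (forall u, normally_weakly_null (T u) /\ in_ball_tree (T u) /\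
      forall B, inevitable B -> exists t b, (t = nil \/ B t) /\
       (forall i, (1 <= i <= length t)%nat -> allowed (b i)) /\
       r + w (a u) + rsum (fun i => w (b i)) (length t) <
        phi (bnorm Y (vadd Y (vadd Y y (vscale Y (a u) (A (x u)))) (A (tree_comb (T u) b t)))))
      in HT.
    exists (graft x T). split; [|split].
    + intros [|v t] u; [apply Hu|].
      replace (graft x T ((v :: t) ++ u :: nil)) with (T v (t ++ u :: nil))
        by (destruct t; easy). apply HT.
    + intros [|v [|v' t]] Ht; [easy | apply Hx|]. now apply (HT v).
    (* B contains some (u), and the t with u :: t in B again form an inevitable set, to which the
       induction hypothesis for the subtree above u applies. If it returns the empty branch, the
       node (u) serves. *)
    + intros B HB. destruct (eventual_nonempty _ _ _ (proj1 (proj2 HB))) as [u HBu].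
      destruct (proj2 (proj2 (HT u)) (fun t => t <> nil /\ B (u :: t))) as
        [t [b [Ht [Hb Hlt]]]].
      { split; [tauto|]. split.
        - apply (proj2 (proj2 HB)) in HBu. intros Hc. apply HBu. intros v.
          destruct (Hc v) as [v' [H1 H2]]. exists v'. split; [|easy].
          intros H3. now apply H1.
        - intros t [_ Ht]. apply (proj2 (proj2 HB)) in Ht. intros Hc. apply Ht. intros v.
          destruct (Hc v) as [v' [H1 H2]]. exists v'. split; [|easy].
          intros H3. apply H1. split; [now destruct t | easy]. }
      exists (u :: t), (fun i => match i with S (S j) => b (S j) | _ => a u end).
      split; [right; destruct Ht as [->|[_ Ht]]; easy|].
      split; [intros [|[|i]] Hi; simpl in Hi; [lia | apply Ha | apply Hb; lia]|].
      simpl length.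
      rewrite rsum_shift, tree_comb_graft, (A_add hA), (A_scale hA), vadd_assoc.
      erewrite rsum_ext with (g := fun i => w (b i)); [lra|].
      intros [|i] Hi; [lia | easy].
Qed.

(** The inevitable set given by the tree estimate meets the tree of a winning strategy at a node
    where the norm both exceeds the budget and obeys the estimate. *)
Lemma upper_tree_not_Bad nm C y r : upper_tree_est A nm C -> (forall a, nm a O = 0) ->
  (forall a n z, (forall i, (1 <= i <= n)%nat -> allowed (a i)) ->
     bnorm Y z <= C * nm a n ->
     phi (bnorm Y (vadd Y y z)) <= r + rsum (fun i => w (a i)) n) ->
  ~ Bad y r.
Proof.
  intros Hest Hnm0 Hphi HB. apply Bad_tree in HB. destruct HB as [x [Hn [Hb HB]]].
  destruct (Hest x Hn Hb) as [B [HB1 HB2]].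
  destruct (HB B HB2) as [t [a [Ht [Ha Hlt]]]].
  apply Rlt_not_le in Hlt. apply Hlt, Hphi; [easy|].
  destruct Ht as [->|Ht]; [|apply (HB1 t Ht)].
  unfold tree_comb; simpl. rewrite (A_0 hA), (norm_0 _ (bnorm_ok Y)), Hnm0. lra.
Qed.
End Game.

(** * The gauge of an absolutely convex hull *)

Section Gauge.
Context {k : kind} {Y : Banach k} (S : Y -> Prop) (alpha beta : R).
Context (Halpha : 0 < alpha) (HS : forall y, bnorm Y y <= alpha -> S y).
Context (HSb : forall y, S y -> bnorm Y y <= beta).

(** [Cv y t] records a representation y = sum c_i s_i with s_i in S and total weight sum |c_i| = t.
    The infimum of such t is the gauge of the absolutely convex hull, and the inductive form allows
    induction on the number of terms. *)
Inductive Cv : Y -> R -> Prop :=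
| Cv_0 : Cv (vzero Y) 0
| Cv_add y t c s : S s -> Cv y t -> Cv (vadd Y y (vscale Y c s)) (t + sabs k c).

Definition gauge (y : Y) : R := epsilon (inhabits 0) (is_glb (Cv y)).

Lemma Cv_ge0 y t : Cv y t -> 0 <= t.
Proof. induction 1 as [|? ? c]; [lra | pose proof (sabs_ge0 k c); lra]. Qed.

(** Adding the term (t' - t) 0 raises the weight without moving y, as 0 lies in S. *)
Lemma Cv_pad y t t' : Cv y t -> t <= t' -> Cv y t'.
Proof.
  intros H Ht. replace t' with (t + sabs k (of_R k (t' - t))) by (rewrite sabs_of_R_pos; lra).
  rewrite <- (vadd_0 y), <- (vscale_0_r k Y (of_R k (t' - t))). apply Cv_add; [|easy].
  apply HS. rewrite (norm_0 _ (bnorm_ok Y)). lra.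
Qed.

Lemma Cv_plus y t y' t' : Cv y t -> Cv y' t' -> Cv (vadd Y y y') (t + t').
Proof.
  intros H; induction 1; [now rewrite vadd_0, Rplus_0_r|].
  rewrite vadd_assoc, <- Rplus_assoc. now apply Cv_add.
Qed.

Lemma Cv_scale c y t : Cv y t -> Cv (vscale Y c y) (sabs k c * t).
Proof.
  induction 1; [rewrite vscale_0_r, Rmult_0_r; constructor|].
  rewrite vscale_distr_v, vscale_assoc, Rmult_plus_distr_l, <- sabs_mul. now apply Cv_add.
Qed.

Lemma Cv_norm y : Cv y (/ alpha * bnorm Y y).
Proof.
  destruct (Req_dec (bnorm Y y) 0) as [E|E].
  - rewrite E, (norm_eq0 _ (bnorm_ok Y) _ E), Rmult_0_r. constructor.
  - pose proof (norm_ge0 _ (bnorm_ok Y) y) as H.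
    pose proof (Rinv_0_lt_compat _ Halpha).
    assert (0 < / bnorm Y y) by (apply Rinv_0_lt_compat; lra).
    replace y with (vadd Y (vzero Y) (vscale Y (of_R k (/ alpha * bnorm Y y))
       (vscale Y (of_R k (alpha * / bnorm Y y)) y))) at 1.
    + rewrite <- (sabs_of_R_pos k (/ alpha * bnorm Y y)) at 2 by nra.
      rewrite <- (Rplus_0_l (sabs _ _)). apply Cv_add; [|constructor]. apply HS.
      rewrite (norm_scale_R _ (bnorm_ok Y)) by nra. right; field; lra.
    + rewrite vadd_0_l, vscale_assoc, <- of_R_mul.
      replace (_ * _) with 1 by (field; lra). now rewrite of_R_1, vscale_1.
Qed.

Lemma Cv_bound y t : Cv y t -> bnorm Y y <= beta * t.
Proof.
  induction 1 as [|y t c s Hs _ IH]; [rewrite (norm_0 _ (bnorm_ok Y)); lra|].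
  eapply Rle_trans; [apply (norm_add _ (bnorm_ok Y))|].
  rewrite (norm_scale _ (bnorm_ok Y)).
  pose proof (sabs_ge0 k c). specialize (HSb s Hs). nra.
Qed.

Lemma gauge_spec y : is_glb (Cv y) (gauge y).
Proof.
  unfold gauge. apply epsilon_spec. apply (glb_exists _ 0); [eexists; apply Cv_norm | apply Cv_ge0].
Qed.

Lemma gauge_le y t : Cv y t -> gauge y <= t.
Proof. apply (gauge_spec y). Qed.

Lemma gauge_ge0 y : 0 <= gauge y.
Proof. apply (gauge_spec y), Cv_ge0. Qed.

Lemma gauge_lt y t : gauge y < t -> Cv y t.
Proof.
  intros H. apply NNPP. intros Hn. apply (Rlt_not_le _ _ H), (gauge_spec y).
  intros s Hs. apply Rnot_lt_le. intros Hst. apply Hn. apply (Cv_pad y s); [easy | lra].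
Qed.

(** A nonzero y has finite positive weight at most |y| / alpha, and beta times that weight bounds
    |y|. *)
Lemma beta_pos y : bnorm Y y <> 0 -> 0 < beta.
Proof.
  intros E. pose proof (norm_ge0 _ (bnorm_ok Y) y). pose proof (Cv_bound y _ (Cv_norm y)).
  pose proof (Rinv_0_lt_compat _ Halpha). assert (0 < / alpha * bnorm Y y) by nra. nra.
Qed.

Lemma norm_le_gauge y : bnorm Y y <= beta * gauge y.
Proof.
  destruct (Req_dec (bnorm Y y) 0) as [E|E].
  - assert (0 <= beta).
    { apply Rle_trans with (bnorm Y y); [lra|]. apply HSb, HS. lra. }
    pose proof (gauge_ge0 y). nra.
  - pose proof (beta_pos y E) as Hb.
    assert (bnorm Y y / beta <= gauge y) as H.
    { apply (gauge_spec y). intros t Ht. apply Cv_bound in Ht.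
      apply (Rmult_le_reg_l beta); [easy|]. field_simplify; lra. }
    apply (Rmult_le_compat_l beta) in H; [|lra]. field_simplify in H; lra.
Qed.

Lemma gauge_scale_le c y : gauge (vscale Y c y) <= sabs k c * gauge y.
Proof.
  pose proof (sabs_ge0 k c).
  apply Rnot_lt_le. intros Hlt.
  (* The infimum need not be attained: the supposed defect d leaves room for a representation of y
     of weight gauge y + d / (|c| + 1). *)
  set (d := gauge (vscale Y c y) - sabs k c * gauge y).
  assert (0 < d) by (unfold d; lra).
  assert (0 < d / (sabs k c + 1)) by (apply Rdiv_lt_0_compat; lra).
  assert (gauge (vscale Y c y) <= sabs k c * (gauge y + d / (sabs k c + 1))) as Hle.
  { apply gauge_le, Cv_scale, gauge_lt. lra. }
  assert ((sabs k c + 1) * (d / (sabs k c + 1)) = d) by (field; lra).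
  unfold d in *. nra.
Qed.

Lemma gauge_is_norm : is_norm Y gauge.
Proof.
  split; [exact gauge_ge0|]. split; [|split].
  - intros y Hy. pose proof (norm_le_gauge y). pose proof (norm_ge0 _ (bnorm_ok Y) y).
    apply (norm_eq0 _ (bnorm_ok Y)). rewrite Hy in *. lra.
  - intros c y. apply Rle_antisym; [apply gauge_scale_le|].
    destruct (Req_dec (sabs k c) 0) as [E|E].
    + rewrite E, Rmult_0_l. apply gauge_ge0.
    (* The reverse inequality is the one just proved, applied to the inverse of c and to c y. *)
    + pose proof (gauge_scale_le (sinv k c) (vscale Y c y)) as H.
      rewrite vscale_assoc, (smul_comm _ (sinv k c)), smul_sinv, vscale_1, sabs_sinv in H
        by easy.
      pose proof (sabs_ge0 k c).
      apply (Rmult_le_compat_l (sabs k c)) in H; [|lra].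
      rewrite <- Rmult_assoc, Rinv_r, Rmult_1_l in H by easy. exact H.
  - intros x y.
    apply Rnot_lt_le. intros Hlt.
    set (d := gauge (vadd Y x y) - (gauge x + gauge y)).
    assert (gauge (vadd Y x y) <= (gauge x + d / 3) + (gauge y + d / 3)).
    { apply gauge_le, Cv_plus; apply gauge_lt; unfold d; lra. }
    unfold d in *; lra.
Qed.

Lemma gauge_equiv_norm : equiv_norm Y gauge.
Proof.
  split; [exact gauge_is_norm|].
  assert (0 <= beta).
  { apply Rle_trans with (bnorm Y (vzero Y)); [apply (norm_ge0 _ (bnorm_ok Y))|].
    apply HSb, HS. rewrite (norm_0 _ (bnorm_ok Y)); lra. }
  (* beta may be 0 when Y is trivial, hence beta + 1. *)
  exists (/ (beta + 1)), (/ alpha).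
  split; [apply Rinv_0_lt_compat; lra|]. split; [now apply Rinv_0_lt_compat|].
  intros y. split; [|apply gauge_le, Cv_norm].
  pose proof (norm_le_gauge y). pose proof (gauge_ge0 y).
  apply (Rmult_le_reg_l (beta + 1)); [lra|].
  rewrite <- Rmult_assoc, Rinv_r by lra. nra.
Qed.

(** * Asymptotic smoothness of the gauge *)

Context {X : Banach k} {A : X -> Y} (hA : bounded_linear X Y A) (sigma kappa : R).
Context (Hsigma : 0 < sigma) (Hkappa : 0 <= kappa).
Context (Hstep : forall s, S s -> exists u : WD X, forall x, proj1_sig u x ->
  bnorm X x <= 1 -> forall a, sabs k a <= sigma ->
  exists s', S s' /\ vadd Y s (vscale Y a (A x)) = vscale Y (of_R k kappa) s').

(* The perturbation a A x of sum c_i s_i is shared out among the terms in proportion to |c_i|. *)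
Lemma Cv_step y t : Cv y t -> exists u : WD X, forall x, proj1_sig u x ->
  bnorm X x <= 1 -> forall a, sabs k a <= sigma * t ->
  Cv (vadd Y y (vscale Y a (A x))) (kappa * t).
Proof.
  induction 1 as [|y t c s Hs Hy [u Hu]].
  - destruct (@WD_inhabited k X) as [u _]. exists u. intros x _ _ a Ha.
    rewrite Rmult_0_r in *. pose proof (sabs_ge0 k a).
    rewrite (sabs_eq0 k a), vscale_0_l, vadd_0 by lra. constructor.
  - pose proof (sabs_ge0 k c) as Hc0. pose proof (Cv_ge0 y t Hy) as Ht0.
    (* A term with c = 0 vanishes and is split off, since c is inverted below. *)
    destruct (Req_dec (sabs k c) 0) as [E|E].
    { exists u. rewrite E, Rplus_0_r.
      rewrite (sabs_eq0 k c E), vscale_0_l, vadd_0. exact Hu. }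
    destruct (Hstep s Hs) as [v Hv]. destruct (WD_inter u v) as [w [Hw1 Hw2]].
    exists w. intros x Hx Hx1 a Ha.
    set (T := t + sabs k c) in *. assert (0 < T) by (unfold T; lra).
    (* The shares a1 + a2 = a: a1 satisfies the bound sigma t of the induction hypothesis, and
       c^(-1) a2 has modulus |a| / T <= sigma, so [Hstep] applies to s. *)
    set (a1 := smul k (of_R k (t / T)) a).
    set (a2 := smul k (of_R k (sabs k c / T)) a).
    assert (0 <= t / T) by (apply Rmult_le_pos; [lra | now apply Rlt_le, Rinv_0_lt_compat]).
    assert (0 <= sabs k c / T) by (apply Rmult_le_pos; [lra | now apply Rlt_le, Rinv_0_lt_compat]).
    assert (sabs k a / T <= sigma) as HaT.
    { apply (Rmult_le_reg_l T); [easy|]. field_simplify; lra. }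
    assert (sabs k a1 <= sigma * t) as Ha1.
    { unfold a1. rewrite sabs_mul, sabs_of_R_pos by easy.
      replace (t / T * sabs k a) with (sabs k a / T * t) by (field; lra). nra. }
    assert (sabs k (smul k (sinv k c) a2) <= sigma) as Ha2.
    { unfold a2. rewrite !sabs_mul, sabs_sinv, sabs_of_R_pos by easy.
      replace (/ sabs k c * (sabs k c / T * sabs k a)) with (sabs k a / T) by (field; lra).
      easy. }
    destruct (Hv x (Hw2 x Hx) Hx1 _ Ha2) as [s' [Hs' Es']].
    specialize (Hu x (Hw1 x Hx) Hx1 a1 Ha1).
    replace (vadd Y (vadd Y y (vscale Y c s)) (vscale Y a (A x))) with
      (vadd Y (vadd Y y (vscale Y a1 (A x))) (vscale Y (smul k c (of_R k kappa)) s')).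
    + replace (kappa * T) with (kappa * t + sabs k (smul k c (of_R k kappa)))
        by (rewrite sabs_mul, sabs_of_R_pos by easy; unfold T; ring).
      now apply Cv_add.
    + rewrite <- vscale_assoc, <- Es', vscale_distr_v, vscale_assoc, smul_assoc,
        smul_sinv, smul_1_l, vadd_swap, <- vscale_distr_s by easy.
      f_equal. f_equal. unfold a1, a2.
      rewrite <- smul_sadd_l, <- of_R_add.
      replace (t / T + sabs k c / T) with 1 by (unfold T in *; field; lra).
      now rewrite of_R_1, smul_1_l.
Qed.

(** As gauge y < 1 + e, y has a representation of weight 1 + e, and [Cv_step] bounds the gauge
    eventually by kappa (1 + e) for every e > 0. *)
Lemma gauge_limsup (y : Y) (L : Type) (le : L -> L -> Prop) (x : L -> X) v :
  gauge y <= 1 -> directed le -> weakly_null_net le x -> (forall l, bnorm X (x l) <= sigma) ->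
  is_limsup le (fun l => gauge (vadd Y y (A (x l)))) v -> v <= kappa.
Proof.
  intros Hy Hdir Hx Hxs Hv.
  enough (forall e, 0 < e -> v <= kappa * (1 + e)) as H.
  { apply Rnot_lt_le. intros Hlt.
    (* For this e, kappa (1 + e) exceeds kappa by less than v - kappa. *)
    specialize (H ((v - kappa) / (kappa + 1) / 2)).
    assert (0 < (v - kappa) / (kappa + 1)) by (apply Rdiv_lt_0_compat; lra).
    assert ((kappa + 1) * ((v - kappa) / (kappa + 1)) = v - kappa) by (field; lra).
    nra. }
  intros e He. destruct (Cv_step y (1 + e)) as [u Hu]; [apply gauge_lt; lra|].
  apply (limsup_le le Hdir _ _ _ Hv).
  destruct (weakly_null_eventually le Hdir (fun l => vscale X (of_R k (/ sigma)) (x l)) u)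
    as [l0 Hl0]; [now apply weakly_null_scale|].
  pose proof (Rinv_0_lt_compat _ Hsigma) as Hsi.
  exists l0. intros l Hl. apply gauge_le.
  (* The net is scaled into the unit ball; the scalar sigma, allowed because sigma <= sigma (1 + e),
     undoes the scaling. *)
  replace (A (x l)) with (vscale Y (of_R k sigma) (A (vscale X (of_R k (/ sigma)) (x l)))).
  - apply Hu; [now apply Hl0| |rewrite sabs_of_R_pos; nra].
    rewrite (norm_scale_R _ (bnorm_ok X)) by lra.
    apply (Rmult_le_reg_l sigma); [easy|]. rewrite <- Rmult_assoc, Rinv_r by lra.
    specialize (Hxs l). lra.
  - rewrite (A_scale hA), vscale_assoc, <- of_R_mul, Rinv_r, of_R_1, vscale_1 by lra. easy.
Qed.

Lemma gauge_rho_le : (exists x, A x <> vzero Y) -> rho gauge A sigma <= kappa - 1.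
Proof.
  intros HA. apply (rho_spec hA gauge sigma gauge_equiv_norm); [lra | easy|].
  intros r [y [Hy [L [le [x [Hdir [Hx [Hxs [v [Hv ->]]]]]]]]]].
  enough (v <= kappa) by lra. eapply gauge_limsup; eauto.
Qed.
End Gauge.

(** * Equivalent norms from tree estimates *)

Section Renorming.
Context {k : kind} {X Y : Banach k} {A : X -> Y} (hA : bounded_linear X Y A).

Lemma rho_ge0 nY sigma : equiv_norm Y nY -> 0 <= sigma ->
  (exists x, A x <> vzero Y) -> 0 <= rho nY A sigma.
Proof.
  intros HY Hs HA. apply (rho_spec hA nY sigma HY Hs HA).
  destruct HA as [x Hx].
  assert (nY (A x) <> 0) as E by (intros E; apply Hx, (norm_eq0 _ (proj1 HY) _ E)).
  pose proof (norm_ge0 _ (proj1 HY) (A x)).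
  assert (0 < / nY (A x)) by (apply Rinv_0_lt_compat; lra).
  assert (nY (vscale Y (of_R k (/ nY (A x))) (A x)) = 1) as E1
    by (rewrite (norm_scale_R _ (proj1 HY)), Rinv_l; lra).
  replace 0 with (nY (vscale Y (of_R k (/ nY (A x))) (A x)) - 1) by lra.
  apply rho_set_const; lra || easy.
Qed.

Lemma AUF_able_of_tree C : 0 < C -> c0_upper_tree_est A C -> AUF_able A.
Proof.
  intros HC Hest.
  set (bad := @Bad k X Y A (fun t => t) (fun a => sabs k a <= 1) (fun _ => 0)).
  (* Budget C + 1: from |y| <= 1, a branch sum with coefficients of modulus at most 1 adds at most
     C. *)
  set (S := fun y => ~ bad y (C + 1)).
  assert (Hmax : forall (a : nat -> scal k) n,
    (forall i, (1 <= i <= n)%nat -> sabs k (a i) <= 1) -> c0_norm a n <= 1).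
  { intros a n. induction n as [|n IH]; intros Ha; unfold c0_norm; simpl; [lra|].
    apply Rmax_lub; [apply IH; intros; apply Ha; lia | apply Ha; lia]. }
  assert (HS : forall y, bnorm Y y <= 1 -> S y).
  { intros y Hy. unfold S, bad. eapply (upper_tree_not_Bad hA _ _ _ _ C); [exact Hest|easy|].
    intros a n z Ha Hz. specialize (Hmax a n Ha).
    pose proof (norm_add _ (bnorm_ok Y) y z).
    assert (0 <= rsum (fun _ => 0) n) by (apply rsum_ge0; intros; lra).
    assert (C * c0_norm a n <= C * 1) by (apply Rmult_le_compat_l; lra). lra. }
  assert (HSb : forall y, S y -> bnorm Y y <= C + 1).
  { intros y Hy. apply Rnot_lt_le. intros Hlt. apply Hy. now apply Bad_now. }
  exists (gauge S). assert (equiv_norm Y (gauge S)) as Heq.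
  { apply (gauge_equiv_norm S 1 (C + 1)); [lra | easy..]. }
  split; [easy|]. exists 1. split; [lra|].
  destruct (classic (exists x, A x <> vzero Y)) as [HA|HA].
  - apply Rle_antisym; [|apply rho_ge0; lra || easy].
    replace 0 with (1 - 1) by ring.
    apply (gauge_rho_le S 1 (C + 1)); try lra; try easy.
    (* Moves with |a| <= 1 leave the budget unchanged, so they keep S inside itself and kappa =
       1. *)
    intros s Hs. destruct (not_Bad_step _ _ _ _ _ Hs) as [u Hu].
    exists u. intros x Hx Hx1 a Ha. exists (vadd Y s (vscale Y a (A x))).
    rewrite of_R_1, vscale_1. split; [|easy].
    unfold S, bad. rewrite <- (Rplus_0_r (C + 1)). now apply Hu.
  - apply rho_zero. intros x. apply NNPP. eauto.
Qed.

Lemma rsum_powr_lp p (a : nat -> scal k) n : 0 < p ->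
  powr (lp_norm p a n) p = rsum (fun i => powr (sabs k (a i)) p) n.
Proof.
  intros Hp. unfold lp_norm. apply powr_inv'; [lra|]. apply rsum_ge0. intros; apply powr_ge0.
Qed.

Lemma p_AUS_able_of_tree p C : 1 < p -> 0 < C -> lp_upper_tree_est A C p -> p_AUS_able A p.
Proof.
  (* For |y| <= 1/2 and |z| <= C |a|_p, (|y| + |z|)^p <= 2^p |y|^p + (2C)^p |a|_p^p <= 1 + D sum
     |a_i|^p. *)
  intros Hp HC Hest. set (D := powr (2 * C) p).
  assert (0 < D) as HD by (apply powr_pos; lra).
  set (bad := @Bad k X Y A (fun t => powr t p) (fun a => True)
                (fun a => D * powr (sabs k a) p)).
  (* All scalars are allowed in this game, so S and its gauge do not depend on sigma: one norm
     serves every sigma. *)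
  set (S := fun y => ~ bad y 1).
  assert (HS : forall y, bnorm Y y <= / 2 -> S y).
  { intros y Hy. unfold S, bad.
    eapply (upper_tree_not_Bad hA _ _ _ _ C); [exact Hest| |].
    { intros a. unfold lp_norm. apply powr_0. }
    intros a n z _ Hz.
    assert (0 <= bnorm Y y) by apply (norm_ge0 _ (bnorm_ok Y)).
    assert (0 <= bnorm Y z) by apply (norm_ge0 _ (bnorm_ok Y)).
    assert (0 <= lp_norm p a n) by apply powr_ge0.
    rewrite rsum_scale, <- rsum_powr_lp by lra.
    apply Rle_trans with (powr (bnorm Y y + bnorm Y z) p).
    { apply powr_mono; [lra|]. split; [apply (norm_ge0 _ (bnorm_ok Y))|].
      apply (norm_add _ (bnorm_ok Y)). }
    eapply Rle_trans; [apply powr_add_le; lra|].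
    unfold D. rewrite Rmult_plus_distr_l, <- !powr_mult by lra.
    apply Rplus_le_compat.
    - rewrite <- (powr_1_l p). apply powr_mono; lra.
    - apply powr_mono; lra. }
  assert (HSb : forall y, S y -> bnorm Y y <= 1).
  { intros y Hy. apply Rnot_lt_le. intros Hlt. apply Hy. apply Bad_now.
    rewrite <- (powr_1_l p). apply powr_lt; lra. }
  exists (gauge S). assert (equiv_norm Y (gauge S)) as Heq.
  { apply (gauge_equiv_norm S (/ 2) 1); [lra | easy..]. }
  split; [easy|]. exists D. intros sigma Hs.
  assert (0 < Rpower sigma p) as Hsp by apply exp_pos.
  enough (rho (gauge S) A sigma <= D * Rpower sigma p) as H.
  { apply (Rmult_le_reg_r (Rpower sigma p)); [easy|].
    unfold Rdiv. rewrite Rmult_assoc, Rinv_l; lra. }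
  destruct (classic (exists x, A x <> vzero Y)) as [HA|HA].
  2:{ rewrite rho_zero; [nra|]. intros x. apply NNPP. eauto. }
  (* K bounds the budget after a move with |a| <= sigma; dividing the position by kappa = K^(1/p)
     brings the budget K back to 1. *)
  set (K := 1 + D * Rpower sigma p). assert (1 <= K) as HK by (unfold K; nra).
  set (kappa := powr K (/ p)).
  assert (0 < kappa) as Hk by (apply powr_pos; lra).
  apply Rle_trans with (kappa - 1).
  2:{ pose proof (powr_inv_le p (D * Rpower sigma p) Hp ltac:(nra)).
      fold K in H. fold kappa in H. unfold K in H. lra. }
  apply (gauge_rho_le S (/ 2) 1); try lra; try easy.
  intros s Hss. destruct (not_Bad_step _ _ _ _ _ Hss) as [u Hu].
  exists u. intros x Hx Hx1 a Ha.
  pose proof (Rinv_0_lt_compat _ Hk) as Hki.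
  exists (vscale Y (of_R k (/ kappa)) (vadd Y s (vscale Y a (A x)))). split.
  (* A win from the divided position with budget 1 scales by kappa to a win from s + a A x with
     budget K, hence with the smaller budget 1 + D |a|^p. *)
  - intros Hb. apply (Hu x Hx Hx1 a I).
    apply (Bad_scale _ _ _ kappa K) in Hb; try lra.
    + rewrite vscale_assoc, <- of_R_mul, Rinv_r, of_R_1, vscale_1 in Hb by lra.
      apply (Bad_mono _ _ _ _ _ _ Hb). rewrite Rmult_1_r. unfold K.
      rewrite <- powr_pos_eq by easy.
      apply Rplus_le_compat_l, Rmult_le_compat_l; [lra|].
      apply powr_mono; [lra|]. split; [apply sabs_ge0 | easy].
    + intros t Ht. rewrite powr_mult by lra. unfold kappa. rewrite powr_inv' by lra. easy.
    + easy.
    + intros b. rewrite sabs_mul, sabs_of_R_pos, powr_mult by (lra || apply sabs_ge0).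
      unfold kappa. rewrite powr_inv' by lra. ring.
  - now rewrite vscale_assoc, <- of_R_mul, Rinv_r, of_R_1, vscale_1 by lra.
Qed.
End Renorming.

(** * Tree estimates from smoothness *)

(** Approximation is from above, so that a bound valid for all |b| <= t covers the scalars of
    modulus r. *)
Lemma unit_grid delta : 0 < delta -> exists g : list R, (forall t, In t g -> 0 <= t) /\
  forall r, 0 <= r <= 1 -> exists t, In t g /\ r <= t <= r + delta.
Proof.
  intros Hd.
  assert (forall N, exists g : list R, (forall t, In t g -> 0 <= t) /\
    forall r, 0 <= r <= INR N * delta -> exists t, In t g /\ r <= t <= r + delta) as H.
  { induction N as [|N [g [Hg1 Hg2]]].
    - exists (0 :: nil). split; [intros t [<-|[]]; lra|].
      intros r Hr. simpl in Hr. exists 0. split; [now left | lra].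
    - rewrite S_INR. pose proof (pos_INR N).
      exists ((INR N + 1) * delta :: g). split; [intros t [<-|Ht]; [nra | auto]|].
      intros r Hr. destruct (Rle_dec r (INR N * delta)) as [H1|H1].
      + destruct (Hg2 r) as [t [Ht1 Ht2]]; [lra|]. exists t. split; [now right | easy].
      + exists ((INR N + 1) * delta). split; [now left | lra]. }
  destruct (INR_unbounded (/ delta)) as [N HN]. destruct (H N) as [g [Hg1 Hg2]].
  exists g. split; [easy|]. intros r Hr. apply Hg2. split; [lra|].
  apply Rmult_gt_compat_r with (r := delta) in HN; [|easy]. rewrite Rinv_l in HN; lra.
Qed.

(** * Total boundedness of sets of linear combinations *)

Section TotallyBounded.
Context {k : kind} {V : VSpace k} (n : V -> R) (Hn : is_norm V n).

(** The centres y' may lie outside T, so the property passes to subsets at once. *)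
Definition totally_bounded (T : V -> Prop) : Prop :=
  forall delta, 0 < delta -> exists l : list V,
    forall y, T y -> exists y', In y' l /\ n (vadd V y (vopp V y')) <= delta.

Lemma tb_subset (T T' : V -> Prop) :
  (forall y, T y -> T' y) -> totally_bounded T' -> totally_bounded T.
Proof. intros H HT d Hd. destruct (HT d Hd) as [l Hl]. exists l. auto. Qed.

Lemma tb_zero : totally_bounded (fun y => y = vzero V).
Proof.
  intros d Hd. exists (vzero V :: nil). intros y ->. exists (vzero V).
  split; [now left|]. rewrite vadd_opp, (norm_0 _ Hn). lra.
Qed.

Lemma tb_add (T1 T2 : V -> Prop) : totally_bounded T1 -> totally_bounded T2 ->
  totally_bounded (fun y => exists y1 y2, T1 y1 /\ T2 y2 /\ y = vadd V y1 y2).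
Proof.
  intros H1 H2 d Hd. destruct (H1 (d / 2)) as [l1 Hl1]; [lra|].
  destruct (H2 (d / 2)) as [l2 Hl2]; [lra|].
  exists (map (fun p => vadd V (fst p) (snd p)) (list_prod l1 l2)).
  intros y [y1 [y2 [Hy1 [Hy2 ->]]]].
  destruct (Hl1 y1 Hy1) as [z1 [Hz1 E1]], (Hl2 y2 Hy2) as [z2 [Hz2 E2]].
  exists (vadd V z1 z2). split.
  - apply in_map_iff. exists (z1, z2). split; [easy | now apply in_prod].
  - rewrite vopp_scale, vscale_distr_v, <- !vopp_scale, vadd_swap.
    eapply Rle_trans; [apply (norm_add _ Hn) | lra].
Qed.

Lemma tb_segment z : totally_bounded (fun y => exists r, Rabs r <= 1 /\ y = vscale V (of_R k r) z).
Proof.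
  intros d Hd. pose proof (norm_ge0 _ Hn z) as Hz.
  set (e := d / (1 + n z)). assert (0 < e) as He by (apply Rdiv_lt_0_compat; lra).
  destruct (unit_grid e He) as [g [_ Hg]].
  exists (map (fun r => vscale V (of_R k r) z) (g ++ map Ropp g)).
  intros y [r [Hr ->]].
  assert (exists t, In t (g ++ map Ropp g) /\ Rabs (r + - t) <= e) as [t [Ht Hrt]].
  { destruct (Rle_dec 0 r) as [H0|H0].
    - rewrite Rabs_pos_eq in Hr by easy. destruct (Hg r) as [t [Ht1 Ht2]]; [lra|].
      exists t. split; [apply in_or_app; now left|]. apply Rabs_le; lra.
    - rewrite Rabs_left in Hr by lra. destruct (Hg (- r)) as [t [Ht1 Ht2]]; [lra|].
      exists (- t). split; [apply in_or_app; right; now apply in_map|]. apply Rabs_le; lra. }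
  exists (vscale V (of_R k t) z). split; [apply in_map_iff; now exists t|].
  rewrite vopp_scale, vscale_assoc, <- of_R_mul, <- vscale_distr_s, <- of_R_add,
    (norm_scale _ Hn), sabs_of_R. replace (r + -1 * t) with (r + - t) by ring.
  apply Rle_trans with (e * n z); [now apply Rmult_le_compat_r|].
  apply Rle_trans with (e * (1 + n z)); [nra|]. right. unfold e. field. lra.
Qed.

Lemma tb_disk z : totally_bounded (fun y => exists b, sabs k b <= 1 /\ y = vscale V b z).
Proof.
  (* Over the complex numbers I is the imaginary unit, and b = r + s I places the disk in a sum of
     two segments; over the reals s = 0. *)
  pose (I := match k return scal k with KR => 1 | KC => (0, 1) end).
  eapply tb_subset; [|apply tb_add; [apply (tb_segment z) | apply (tb_segment (vscale V I z))]].
  intros y [b [Hb ->]]. simpl.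
  assert (exists r s, Rabs r <= 1 /\ Rabs s <= 1 /\
    b = sadd k (of_R k r) (smul k (of_R k s) I)) as [r [s [Hr [Hs ->]]]].
  { subst I. clear - Hb. destruct k; simpl in *.
    - exists b, 0. rewrite Rabs_R0. repeat split; try lra.
    - destruct b as [r s]; simpl in *. exists r, s.
      assert (r * r + s * s <= 1) as H.
      { rewrite <- (sqrt_sqrt (r * r + s * s)) by nra.
        pose proof (sqrt_pos (r * r + s * s)). nra. }
      repeat split; [apply Rabs_le; nra | apply Rabs_le; nra | f_equal; ring]. }
  exists (vscale V (of_R k r) z), (vscale V (of_R k s) (vscale V I z)).
  split; [now exists r|]. split; [now exists s|].
  now rewrite vscale_assoc, vscale_distr_s.
Qed.

Lemma tb_comb (z : nat -> V) m : totally_bounded (fun y => exists a : nat -> scal k,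
  (forall i, (1 <= i <= m)%nat -> sabs k (a i) <= 1) /\
  y = vsum V (fun i => vscale V (a i) (z i)) m).
Proof.
  induction m as [|m IH].
  - eapply tb_subset; [|apply tb_zero]. intros y [a [_ ->]]. easy.
  - eapply tb_subset; [|apply tb_add; [apply IH | apply (tb_disk (z (S m)))]].
    intros y [a [Ha ->]]. simpl. do 2 eexists. split; [|split; [|reflexivity]].
    + exists a. split; [intros; apply Ha; lia | easy].
    + exists (a (S m)). split; [apply Ha; lia | easy].
Qed.
End TotallyBounded.

Lemma WD_finite k (X : Banach k) (I : Type) (P : I -> X -> Prop) (l : list I) :
  (forall i, In i l -> exists u : WD X, forall x, proj1_sig u x -> P i x) ->
  exists u : WD X, forall x, proj1_sig u x -> forall i, In i l -> P i x.
Proof.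
  induction l as [|i l IH]; intros H.
  - destruct (@WD_inhabited k X) as [u _]. exists u. intros x _ i [].
  - destruct IH as [u Hu]; [intros; apply H; now right|].
    destruct (H i (or_introl eq_refl)) as [v Hv].
    destruct (WD_inter u v) as [w [H1 H2]]. exists w.
    intros x Hx j [<-|Hj]; auto.
Qed.

(** * Tree estimates from an asymptotic bound on the norm *)

Section TreeEstimates.
Context {k : kind} {X Y : Banach k} {A : X -> Y} (hA : bounded_linear X Y A).
Context (nY : Y -> R) (HY : equiv_norm Y nY).

(** Otherwise each u contains a violating vector; these form a weakly null net whose upper limit
    exceeds the supremum defining [rho]. *)
Lemma rho_weak_nbhd y sigma eps : nY y <= 1 -> 0 < sigma -> 0 < eps ->
  exists u : WD X, forall x, proj1_sig u x -> bnorm X x <= sigma ->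
    nY (vadd Y y (A x)) <= 1 + rho nY A sigma + eps.
Proof.
  intros Hy Hs He. destruct (classic (exists x, A x <> vzero Y)) as [HA|HA].
  - apply NNPP. intros Hn.
    assert (forall u : WD X, exists x, proj1_sig u x /\ bnorm X x <= sigma /\
      1 + rho nY A sigma + eps < nY (vadd Y y (A x))) as H.
    { intros u. apply NNPP. intros Hu. apply Hn. exists u. intros x Hx Hxs.
      apply Rnot_lt_le. intros Hlt. apply Hu. now exists x. }
    pose (f := fun u => proj1_sig (constructive_indefinite_description _ (H u))).
    pose proof (fun u => proj2_sig (constructive_indefinite_description _ (H u))) as Hf.
    fold f in Hf.
    change (forall u, proj1_sig u (f u) /\ bnorm X (f u) <= sigma /\
      1 + rho nY A sigma + eps < nY (vadd Y y (A (f u)))) in Hf.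
    destruct (equiv_norm_bound hA nY HY) as [K [HK HKx]].
    destruct (limsup_exists (@WD_le k X) WD_directed (fun u => nY (vadd Y y (A (f u)))) 0
      (1 + K * sigma)) as [v Hv].
    { intros u. split; [apply (norm_ge0 _ (proj1 HY))|].
      eapply Rle_trans; [apply (norm_add _ (proj1 HY))|].
      specialize (HKx (f u)). destruct (Hf u) as [_ [H1 _]]. nra. }
    assert (1 + rho nY A sigma + eps <= v) as Hge.
    { apply (limsup_ge (@WD_le k X) WD_directed _ _ _ Hv). intros u.
      destruct (Hf u) as [_ [_ H1]]. lra. }
    assert (v - 1 <= rho nY A sigma); [|lra].
    apply (rho_spec hA nY sigma HY); [lra | easy|].
    exists y. split; [easy|]. exists (WD X), (@WD_le k X), f.
    split; [apply WD_directed|]. split; [apply WD_net_weakly_null; intros u; apply Hf|].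
    split; [intros u; apply Hf|]. now exists v.
  - assert (forall x, A x = vzero Y) as H0 by (intros x; apply NNPP; eauto).
    destruct (@WD_inhabited k X) as [u _]. exists u. intros x _ _.
    rewrite H0, vadd_0, (rho_zero nY sigma H0). lra.
Qed.

Lemma A_vsum (f : nat -> X) n : A (vsum X f n) = vsum Y (fun i => A (f i)) n.
Proof. induction n; simpl; [apply (A_0 hA) | now rewrite (A_add hA), IHn]. Qed.

Lemma A_tree_comb x a t :
  A (tree_comb x a t) = vsum Y (fun i => vscale Y (a i) (A (x (firstn i t)))) (length t).
Proof.
  unfold tree_comb. rewrite A_vsum. apply vsum_ext. intros; apply (A_scale hA).
Qed.

Lemma tree_comb_snoc (x : list (WD X) -> X) a t u :
  tree_comb x a (t ++ u :: nil) =
  vadd X (tree_comb x a t) (vscale X (a (S (length t))) (x (t ++ u :: nil))).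
Proof.
  unfold tree_comb. rewrite length_app. simpl length. rewrite Nat.add_1_r. cbn [vsum].
  f_equal.
  - apply vsum_ext. intros i Hi. rewrite firstn_app.
    replace (i - length t)%nat with 0%nat by lia. simpl. now rewrite app_nil_r.
  - now rewrite (firstn_all2 (t ++ u :: nil)) by (rewrite length_app; simpl; lia).
Qed.

(* [H s tau] bounds the upper limit of |y + b A x| over weakly null x in the unit ball, for
   |y| = s and |b| <= tau. *)
Context (H : R -> R -> R) (nm : (nat -> scal k) -> nat -> R) (c0 : R).
Context (H_unif : forall M eps, 0 < eps -> exists delta, 0 < delta /\
  forall s tau s' tau', 0 <= s <= M -> 0 <= tau <= M ->
    0 <= s' <= s + delta -> 0 <= tau' <= tau + delta -> H s' tau' <= H s tau + eps).
Context (H_asymp : forall y tau eps, 0 <= tau -> 0 < eps -> exists u : WD X,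
  forall x, proj1_sig u x -> bnorm X x <= 1 -> forall b, sabs k b <= tau ->
    nY (vadd Y y (vscale Y b (A x))) <= H (nY y) tau + eps).
Context (c0_ge0 : 0 <= c0).
Context (nm_0 : forall a, nm a O = 0).
Context (nm_ge0 : forall a n, 0 <= nm a n).
Context (nm_scale : forall r a n, 0 <= r ->
  nm (fun i => smul k (of_R k r) (a i)) n = r * nm a n).
Context (nm_coord : forall a n i, (1 <= i <= n)%nat -> sabs k (a i) <= nm a n).
Context (nm_mono : forall a n, nm a n <= nm a (S n)).
(** The induction inequality: a constant c >= c0 survives the addition of one coordinate, so only
    errors can enlarge it. *)
Context (nm_H : forall c s a n, c0 <= c -> 0 <= s <= c * nm a n ->
  H s (sabs k (a (S n))) <= c * nm a (S n)).

(** One neighbourhood serves a finite net of T and a finite grid of moduli. The error eps is shared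
    between [H_asymp] at a net point, the change of H, and the distance of y to the net. *)
Lemma asymp_uniform (T : Y -> Prop) M eps : totally_bounded nY T ->
  (forall y, T y -> nY y <= M) -> 0 < eps ->
  exists u : WD X, forall x, proj1_sig u x -> bnorm X x <= 1 ->
    forall y b, T y -> sabs k b <= 1 ->
      nY (vadd Y y (vscale Y b (A x))) <= H (nY y) (sabs k b) + eps.
Proof.
  intros HT HM He.
  (* max(M, 1) bounds both the norms on T and the moduli |b|. *)
  destruct (H_unif (Rmax M 1) (eps / 3)) as [d [Hd Hunif]]; [lra|].
  set (e := Rmin d (eps / 3)).
  assert (0 < e) as He0 by (apply Rmin_pos; lra).
  assert (e <= d) as Hed by apply Rmin_l.
  assert (e <= eps / 3) as Hee by apply Rmin_r.
  destruct (HT e He0) as [l Hl]. destruct (unit_grid e He0) as [g [Hg1 Hg2]].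
  destruct (WD_finite k X (Y * R) (fun i x => bnorm X x <= 1 ->
    forall b, sabs k b <= snd i ->
    nY (vadd Y (fst i) (vscale Y b (A x))) <= H (nY (fst i)) (snd i) + eps / 3)
    (list_prod l g)) as [u Hu].
  { intros [y' t] Hi. apply in_prod_iff in Hi. simpl. apply H_asymp; [apply Hg1; tauto | lra]. }
  exists u. intros x Hx Hx1 y b Hy Hb.
  destruct (Hl y Hy) as [y' [Hy' Hyy]].
  pose proof (sabs_ge0 k b) as Hb0.
  destruct (Hg2 (sabs k b)) as [t [Ht Hbt]]; [lra|].
  specialize (Hu x Hx (y', t) (in_prod _ _ _ _ Hy' Ht) Hx1 b ltac:(simpl; lra)).
  simpl in Hu.
  pose proof (norm_ge0 _ (proj1 HY) y). pose proof (norm_ge0 _ (proj1 HY) y').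
  assert (nY y' <= nY y + e) as Hy'y.
  { eapply Rle_trans; [apply (norm_sub_le _ (proj1 HY) y' y)|].
    rewrite <- (norm_opp _ (proj1 HY) (vadd Y y' (vopp Y y))).
    rewrite !vopp_scale, vscale_distr_v, vscale_assoc, <- of_R_mul.
    replace (-1 * -1) with 1 by ring.
    rewrite of_R_1, vscale_1, vadd_comm, <- vopp_scale. lra. }
  assert (H (nY y') t <= H (nY y) (sabs k b) + eps / 3).
  { specialize (HM y Hy). pose proof (Rmax_l M 1). pose proof (Rmax_r M 1).
    apply Hunif; lra. }
  assert (nY (vadd Y y (vscale Y b (A x))) <= nY (vadd Y y' (vscale Y b (A x))) + e); [|lra].
  eapply Rle_trans; [apply (norm_sub_le _ (proj1 HY) _ (vadd Y y' (vscale Y b (A x))))|].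
  apply Rplus_le_compat_l.
  now rewrite vopp_scale, vscale_distr_v, <- !vopp_scale, vadd_swap, vadd_opp, vadd_0.
Qed.

(** Uniformity over the branch sums with nm a <= 1, which form a totally bounded set, with error c'
    - c. Homogeneity reduces the claim to coefficients with nm a = 1. *)
Lemma tree_step x t c c' : normally_weakly_null x -> in_ball_tree x -> c0 <= c < c' ->
  (forall a, nY (A (tree_comb x a t)) <= c * nm a (length t)) ->
  eventual (fun u => forall a,
    nY (A (tree_comb x a (t ++ u :: nil))) <= c' * nm a (length (t ++ u :: nil))).
Proof.
  intros Hx Hxb Hc Ht. set (n := length t).
  set (T := fun y => exists a, (forall i, (1 <= i <= n)%nat -> sabs k (a i) <= 1) /\
    nm a n <= 1 /\ y = A (tree_comb x a t)).
  destruct (asymp_uniform T c (c' - c)) as [u0 Hu0].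
  { eapply tb_subset; [|apply (tb_comb _ (proj1 HY) (fun i => A (x (firstn i t))) n)].
    intros y [a [Ha [_ ->]]]. exists a. split; [easy | apply A_tree_comb]. }
  { intros y [a [_ [Ha ->]]]. specialize (Ht a). fold n in Ht. nra. }
  { lra. }
  apply eventual_intro. exists u0. intros u Hu a.
  replace (length (t ++ u :: nil)) with (S n)
    by (rewrite length_app; simpl; unfold n; lia).
  assert (forall b, nm b (S n) = 1 -> nY (A (tree_comb x b (t ++ u :: nil))) <= c') as Hnorm.
  { intros b Hb. rewrite tree_comb_snoc, (A_add hA), (A_scale hA).
    assert (nm b n <= 1) as Hbn by (rewrite <- Hb; apply nm_mono).
    eapply Rle_trans.
    - apply Hu0; [apply Hu, Hx | apply Hxb; now destruct t | |
        fold n; rewrite <- Hb; apply nm_coord; lia].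
      exists b. split; [|easy]. intros i Hi. rewrite <- Hb. apply nm_coord. lia.
    - fold n. enough (H (nY (A (tree_comb x b t))) (sabs k (b (S n))) <= c * nm b (S n)) by
        (rewrite Hb in *; lra).
      apply nm_H; [lra|]. split; [apply (norm_ge0 _ (proj1 HY)) | apply Ht]. }
  (* If nm a = 0 normalisation is impossible, but then every coefficient is 0. *)
  destruct (Req_dec (nm a (S n)) 0) as [E|E].
  - rewrite E, Rmult_0_r, A_tree_comb.
    rewrite (vsum_ext _ _ _ (fun i => vscale Y (s0 k) (A (x (firstn i (t ++ u :: nil)))))).
    + rewrite vsum_scale, vscale_0_l, (norm_0 _ (proj1 HY)). lra.
    + intros i Hi. f_equal. apply sabs_eq0.
      pose proof (sabs_ge0 k (a i)). apply Rle_antisym; [|easy]. rewrite <- E.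
      apply nm_coord. rewrite length_app in Hi. simpl in Hi. unfold n. lia.
  - pose proof (nm_ge0 a (S n)). set (N := nm a (S n)) in *.
    assert (0 < / N) as HN by (apply Rinv_0_lt_compat; lra).
    specialize (Hnorm (fun i => smul k (of_R k (/ N)) (a i))).
    rewrite nm_scale in Hnorm by lra. fold N in Hnorm.
    specialize (Hnorm ltac:(field; lra)).
    replace (tree_comb x (fun i => smul k (of_R k (/ N)) (a i)) (t ++ u :: nil)) with
      (vscale X (of_R k (/ N)) (tree_comb x a (t ++ u :: nil))) in Hnorm.
    + rewrite (A_scale hA), (norm_scale_R _ (proj1 HY)) in Hnorm by lra.
      apply (Rmult_le_reg_l (/ N)); [easy|].
      replace (/ N * (c' * N)) with c' by (field; lra). easy.
    + unfold tree_comb. rewrite <- vsum_scale. apply vsum_ext. intros; apply vscale_assoc.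
Qed.

Lemma upper_tree_est_of_asymp : exists C, 0 < C /\ upper_tree_est A nm C.
Proof.
  destruct (proj2 HY) as [al [be [Hal [Hbe Hab]]]].
  (* Strictly increasing from c0 and below c0 + 1: each level has a positive error margin, while one
     constant bounds all levels. *)
  pose (c := fun n => c0 + 1 - / (INR n + 1)).
  assert (Hc : forall n, c0 <= c n < c (S n)).
  { intros n. unfold c. rewrite S_INR. pose proof (pos_INR n).
    assert (/ (INR n + 1) <= / 1) by (apply Rinv_le_contravar; lra).
    assert (/ (INR n + 1 + 1) < / (INR n + 1)) by (apply Rinv_lt_contravar; nra). lra. }
  exists ((c0 + 1) / al). split; [apply Rdiv_lt_0_compat; lra|].
  intros x Hx Hxb.
  (* The inevitable subset consists of the nodes of length n where the estimate holds in nY with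
     constant c n; dividing by al returns to the original norm. *)
  exists (fun t => t <> nil /\ forall a,
    nY (A (tree_comb x a t)) <= c (length t) * nm a (length t)).
  split; [|split; [tauto|]].
  - intros t [Ht1 Ht2]. split; [easy|]. intros a.
    specialize (Ht2 a). destruct (Hab (A (tree_comb x a t))) as [H1 _].
    assert (c (length t) <= c0 + 1) as Hcl.
    { unfold c. pose proof (pos_INR (length t)).
      assert (0 < / (INR (length t) + 1)) by (apply Rinv_0_lt_compat; lra). lra. }
    specialize (nm_ge0 a (length t)).
    apply (Rmult_le_reg_l al); [easy|].
    replace (al * ((c0 + 1) / al * nm a (length t))) with ((c0 + 1) * nm a (length t))
      by (field; lra). nra.
  - assert (forall t, (forall a, nY (A (tree_comb x a t)) <= c (length t) * nm a (length t)) ->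
      eventual (fun u => t ++ u :: nil <> nil /\ forall a,
       nY (A (tree_comb x a (t ++ u :: nil))) <=
         c (length (t ++ u :: nil)) * nm a (length (t ++ u :: nil)))) as Hstep.
    { intros t Ht.
      pose proof (tree_step x t _ _ Hx Hxb (Hc (length t)) Ht) as Hev.
      intros Hcof. apply Hev. intros u. destruct (Hcof u) as [v [Hv1 Hv2]].
      exists v. split; [|easy]. intros Hv. apply Hv1. split; [now destruct t|].
      intros a. replace (c (length (t ++ v :: nil))) with (c (S (length t))); [apply Hv|].
      rewrite length_app. simpl. f_equal. lia. }
    split; [|intros t [_ Ht]; now apply Hstep].
    apply (Hstep nil). intros a. unfold tree_comb. simpl.
    rewrite (A_0 hA), (norm_0 _ (proj1 HY)), nm_0. lra.
Qed.
End TreeEstimates.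

(** * The c_0 and l_p bounds *)

Section Instances.
Context {k : kind} {X Y : Banach k} {A : X -> Y} (hA : bounded_linear X Y A).

(** Homogeneity: y / m lies in the unit ball and |b| / m <= sigma, so the definition of [rho]
    applies after division by m. *)
Lemma rho_asymp nY (HY : equiv_norm Y nY) y m tau sigma eps :
  nY y <= m -> 0 < m -> 0 <= tau <= sigma * m -> 0 < sigma -> 0 < eps ->
  exists u : WD X, forall x, proj1_sig u x -> bnorm X x <= 1 ->
    forall b, sabs k b <= tau ->
      nY (vadd Y y (vscale Y b (A x))) <= m * (1 + rho nY A sigma) + eps.
Proof.
  intros Hy Hm Ht Hs He. pose proof (Rinv_0_lt_compat _ Hm) as Hmi.
  destruct (rho_weak_nbhd hA nY HY (vscale Y (of_R k (/ m)) y) sigma (eps / m)) as [u Hu].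
  { rewrite (norm_scale_R _ (proj1 HY)) by lra.
    apply (Rmult_le_reg_l m); [easy|]. rewrite <- Rmult_assoc, Rinv_r; lra. }
  { easy. }
  { now apply Rdiv_lt_0_compat. }
  destruct (WD_scale u (/ m * tau)) as [w Hw]; [apply Rmult_le_pos; lra|].
  exists w. intros x Hx Hx1 b Hb. pose proof (sabs_ge0 k b).
  pose proof (norm_ge0 _ (bnorm_ok X) x).
  set (b' := smul k (of_R k (/ m)) b).
  assert (sabs k b' = / m * sabs k b) as Eb
    by (unfold b'; now rewrite sabs_mul, sabs_of_R_pos by lra).
  assert (sabs k b' <= sigma) as Hbs.
  { rewrite Eb. apply (Rmult_le_reg_l m); [easy|]. rewrite <- Rmult_assoc, Rinv_r; lra. }
  assert (sabs k b' <= / m * tau) as Hbt by (rewrite Eb; apply Rmult_le_compat_l; lra).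
  specialize (Hu (vscale X b' x) (Hw x Hx b' Hbt)).
  rewrite (norm_scale _ (bnorm_ok X)), (A_scale hA) in Hu.
  assert (sabs k b' * bnorm X x <= sigma) as Hbx by (pose proof (sabs_ge0 k b'); nra).
  specialize (Hu Hbx). unfold b' in Hu.
  rewrite <- vscale_assoc, <- vscale_distr_v, (norm_scale_R _ (proj1 HY)) in Hu by lra.
  apply (Rmult_le_reg_l (/ m)); [easy|]. eapply Rle_trans; [exact Hu|].
  right. field. lra.
Qed.

Lemma c0_norm_ge0 (a : nat -> scal k) n : 0 <= c0_norm a n.
Proof.
  unfold c0_norm. induction n; simpl; [lra|]. eapply Rle_trans; [exact IHn | apply Rmax_l].
Qed.

Lemma tree_of_AUF_able : AUF_able A -> exists C, 0 < C /\ c0_upper_tree_est A C.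
Proof.
  intros [nY [HY [sigma [Hs Hrho]]]].
  pose proof (Rinv_0_lt_compat _ Hs) as Hsi.
  (* max(s, tau / sigma) is the least m with s <= m and tau <= sigma m; since [rho] vanishes at
     sigma, m is itself the asymptotic bound. With c >= 1 / sigma both terms stay below c max
     |a_i|. *)
  apply (upper_tree_est_of_asymp hA nY HY (fun s tau => Rmax s (/ sigma * tau)) _ (/ sigma)).
  - intros M eps He. exists (Rmin eps (sigma * eps)).
    assert (0 < sigma * eps) by nra.
    split; [now apply Rmin_pos|]. intros s tau s' tau' Hs1 Ht Hs' Ht'.
    pose proof (Rmin_l eps (sigma * eps)). pose proof (Rmin_r eps (sigma * eps)).
    pose proof (Rmax_l s (/ sigma * tau)). pose proof (Rmax_r s (/ sigma * tau)).
    apply Rmax_lub; [lra|].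
    assert (/ sigma * tau' <= / sigma * (tau + sigma * eps)) as Hle
      by (apply Rmult_le_compat_l; lra).
    rewrite Rmult_plus_distr_l, <- Rmult_assoc with (r1 := / sigma), Rinv_l in Hle by lra. lra.
  - intros y tau eps Ht He. set (m := Rmax (nY y) (/ sigma * tau)).
    pose proof (norm_ge0 _ (proj1 HY) y) as Hy.
    assert (nY y <= m) as Hm1 by apply Rmax_l.
    assert (/ sigma * tau <= m) as Hm2 by apply Rmax_r.
    (* m may be 0, whereas [rho_asymp] divides by it; hence the extra eps / 2. *)
    destruct (rho_asymp nY HY y (m + eps / 2) tau sigma (eps / 2)) as [u Hu]; try lra.
    + split; [easy|]. apply (Rmult_le_compat_l sigma) in Hm2; [|lra].
      rewrite <- Rmult_assoc, Rinv_r in Hm2 by lra. nra.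
    + exists u. intros x Hx Hx1 b Hb. specialize (Hu x Hx Hx1 b Hb).
      rewrite Hrho in Hu. lra.
  - lra.
  - easy.
  - apply c0_norm_ge0.
  - intros r a n Hr. unfold c0_norm. induction n; simpl; [ring|].
    now rewrite IHn, sabs_mul, sabs_of_R_pos, RmaxRmult by easy.
  - intros a n i Hi. unfold c0_norm. induction n; [lia|]. simpl.
    destruct (Nat.eq_dec i (S n)) as [->|]; [apply Rmax_r|].
    eapply Rle_trans; [apply IHn; lia | apply Rmax_l].
  - intros a n. apply Rmax_l.
  - intros c s a n Hc Hsn.
    pose proof (Rmax_l (c0_norm a n) (sabs k (a (S n)))).
    pose proof (Rmax_r (c0_norm a n) (sabs k (a (S n)))).
    pose proof (sabs_ge0 k (a (S n))).
    change (c0_norm a (S n)) with (Rmax (c0_norm a n) (sabs k (a (S n)))).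
    apply Rmax_lub.
    + apply Rle_trans with (c * c0_norm a n); [easy|]. apply Rmult_le_compat_l; lra.
    + apply Rmult_le_compat; lra.
Qed.

Lemma tree_of_p_AUS_able p : 1 < p -> p_AUS_able A p ->
  exists C, 0 < C /\ lp_upper_tree_est A C p.
Proof.
  intros Hp [nY [HY [M0 HM0]]].
  destruct (equiv_norm_bound hA nY HY) as [K [HK HKx]].
  set (M := Rmax M0 0). assert (0 <= M) as HM by apply Rmax_r.
  assert (forall sigma, 0 < sigma -> rho nY A sigma <= M * powr sigma p) as Hrho.
  { intros sigma Hs. specialize (HM0 sigma Hs). rewrite powr_pos_eq by easy.
    assert (0 < Rpower sigma p) by apply exp_pos.
    apply Rle_trans with (M0 * Rpower sigma p).
    - apply (Rmult_le_compat_r (Rpower sigma p)) in HM0; [|lra].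
      unfold Rdiv in HM0. rewrite Rmult_assoc, Rinv_l in HM0; lra.
    - apply Rmult_le_compat_r; [lra | apply Rmax_l]. }
  (* The first summand handles |y| <= tau by the triangle inequality, the second handles tau < |y|
     through [powr_1_add_le]. *)
  set (D := powr (1 + K) p + p * M * exp (p * M)).
  assert (powr (1 + K) p <= D /\ p * M * exp (p * M) <= D) as [HD1 HD2].
  { pose proof (powr_ge0 (1 + K) p). pose proof (exp_pos (p * M)).
    assert (0 <= p * M * exp (p * M)) by (apply Rmult_le_pos; nra). unfold D. lra. }
  assert (0 < D) as HD by (pose proof (powr_pos (1 + K) p); lra).
  assert (0 < / p) as Hpi by (apply Rinv_0_lt_compat; lra).
  assert (Hinner : forall s tau, 0 <= powr s p + D * powr tau p).
  { intros s tau. pose proof (powr_ge0 s p). pose proof (powr_ge0 tau p). nra. }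
  apply (upper_tree_est_of_asymp hA nY HY
    (fun s tau => powr (powr s p + D * powr tau p) (/ p)) _ (powr D (/ p))).
  - intros B eps He.
    (* Uniform continuity of the outer root on the range of s^p + D tau^p, then of the inner power
       with its error divided by 1 + D. *)
    destruct (powr_unif_cont (/ p) ((1 + D) * powr B p) eps) as [d1 [Hd1 H1]]; [easy..|].
    destruct (powr_unif_cont p B (d1 / (1 + D))) as [d [Hd Hu]]; [lra|apply Rdiv_lt_0_compat; lra|].
    exists d. split; [easy|]. intros s tau s' tau' Hs Ht Hs' Ht'.
    assert (powr s p <= powr B p) by (apply powr_mono; lra).
    assert (powr tau p <= powr B p) by (apply powr_mono; lra).
    apply H1.
    + split; [apply Hinner | nra].
    + split; [apply Hinner|].
      specialize (Hu tau tau' Ht Ht') as Hu2. specialize (Hu s s' Hs Hs').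
      replace d1 with ((1 + D) * (d1 / (1 + D))) by (field; lra). nra.
  - intros y tau eps Ht He. pose proof (norm_ge0 _ (proj1 HY) y) as Hy.
    (* For |y| <= tau no smoothness is used: |y + b A x| <= (1 + K) tau <= D^(1/p) tau. *)
    destruct (Rle_lt_dec (nY y) tau) as [Hyt|Hyt].
    + destruct (@WD_inhabited k X) as [u _]. exists u. intros x _ Hx1 b Hb.
      apply Rle_trans with ((1 + K) * tau).
      * eapply Rle_trans; [apply (norm_add _ (proj1 HY))|].
        rewrite (norm_scale _ (proj1 HY)).
        assert (sabs k b * nY (A x) <= tau * K); [|lra].
        apply Rmult_le_compat; [apply sabs_ge0 | apply (norm_ge0 _ (proj1 HY)) | exact Hb |].
        specialize (HKx x). nra.
      * enough ((1 + K) * tau <= powr (powr (nY y) p + D * powr tau p) (/ p)) by lra.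
        apply (powr_le_inv p); [lra | nra | apply powr_ge0|].
        rewrite powr_inv', powr_mult by (lra || apply Hinner).
        pose proof (powr_ge0 (nY y) p). pose proof (powr_ge0 tau p). nra.
    + destruct (Rle_lt_or_eq_dec 0 tau Ht) as [Ht0|<-].
      * set (s := nY y) in *. set (sg := tau / s).
        assert (0 < sg) as Hsg by (apply Rdiv_lt_0_compat; lra).
        assert (sg * s = tau) as Esg by (unfold sg; field; lra).
        assert (sg <= 1) as Hsg1 by nra.
        destruct (rho_asymp nY HY y s tau sg eps) as [u Hu]; [apply Rle_refl | lra.. |].
        exists u. intros x Hx Hx1 b Hb. eapply Rle_trans; [now apply Hu|].
        apply Rplus_le_compat_r.
        assert (0 <= powr sg p <= 1) as Hsp.
        { split; [apply powr_ge0|]. rewrite <- (powr_1_l p). apply powr_mono; lra. }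
        apply Rle_trans with (s * (1 + M * powr sg p)).
        { apply Rmult_le_compat_l; [lra|]. specialize (Hrho sg Hsg). lra. }
        apply (powr_le_inv p); [lra | apply Rmult_le_pos; nra | apply powr_ge0|].
        rewrite powr_inv' by (lra || apply Hinner).
        rewrite powr_mult by nra.
        replace (powr s p + D * powr tau p) with (powr s p * (1 + D * powr sg p)).
        -- apply Rmult_le_compat_l; [apply powr_ge0|].
           eapply Rle_trans; [apply powr_1_add_le; lra|]. nra.
        -- rewrite <- Esg, powr_mult by lra. ring.
      * destruct (@WD_inhabited k X) as [u _]. exists u. intros x _ Hx1 b Hb.
        pose proof (sabs_ge0 k b).
        rewrite (sabs_eq0 k b), vscale_0_l, vadd_0, powr_0, Rmult_0_r, Rplus_0_r, powr_inv
          by lra. lra.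
  - apply powr_ge0.
  - intros a. unfold lp_norm. apply powr_0.
  - intros; apply powr_ge0.
  - intros r a n Hr. unfold lp_norm.
    rewrite (rsum_ext _ (fun i => powr r p * powr (sabs k (a i)) p)).
    + rewrite rsum_scale, powr_mult, powr_inv; try lra; try apply powr_ge0.
      apply rsum_ge0. intros; apply powr_ge0.
    + intros i _. rewrite sabs_mul, sabs_of_R_pos, powr_mult; auto using sabs_ge0.
  - intros a n i Hi.
    apply (powr_le_inv p); [lra | apply sabs_ge0 | apply powr_ge0|].
    rewrite rsum_powr_lp by lra.
    induction n; [lia|]. simpl.
    pose proof (powr_ge0 (sabs k (a (S n))) p).
    destruct (Nat.eq_dec i (S n)) as [->|].
    + assert (0 <= rsum (fun i => powr (sabs k (a i)) p) n)
        by (apply rsum_ge0; intros; apply powr_ge0). lra.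
    + specialize (IHn ltac:(lia)). lra.
  - intros a n. apply (powr_le_inv p); [lra | apply powr_ge0 | apply powr_ge0|].
    rewrite !rsum_powr_lp by lra. simpl. pose proof (powr_ge0 (sabs k (a (S n))) p). lra.
  - intros c s a n Hc Hs.
    assert (0 <= c) as Hc0 by (eapply Rle_trans; [apply powr_ge0 | exact Hc]).
    assert (0 <= lp_norm p a n) by apply powr_ge0.
    assert (0 <= lp_norm p a (S n)) by apply powr_ge0.
    apply (powr_le_inv p); [lra | apply powr_ge0 | nra|].
    rewrite powr_inv' by (lra || apply Hinner).
    assert (powr s p <= powr c p * powr (lp_norm p a n) p) as H1
      by (rewrite <- powr_mult by lra; apply powr_mono; lra).
    (* This is where c0 = D^(1/p) enters: s^p + D |a|^p is then at most c^p times the p-th power of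
       the longer norm. *)
    assert (D <= powr c p) as H2.
    { rewrite <- (powr_inv' p D) by lra. apply powr_mono; [lra|].
      split; [apply powr_ge0 | easy]. }
    rewrite powr_mult, rsum_powr_lp by lra. rewrite rsum_powr_lp in H1 by lra.
    cbn [rsum]. pose proof (powr_ge0 (sabs k (a (S n))) p). nra.
Qed.
End Instances.

Theorem theorem1p1 (k : kind) (X Y : Banach k) (A : X -> Y) (hA : bounded_linear X Y A) :
  (AUF_able A <-> exists C, 0 < C /\ c0_upper_tree_est A C) /\
  (forall p, 1 < p -> (p_AUS_able A p <-> exists C, 0 < C /\ lp_upper_tree_est A C p)).
Proof.
  split; [|intros p Hp]; split.
  - exact (tree_of_AUF_able hA).
  - intros [C [HC H]]. exact (AUF_able_of_tree hA C HC H).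
  - exact (tree_of_p_AUS_able hA p Hp).
  - intros [C [HC H]]. exact (p_AUS_able_of_tree hA p C Hp HC H).
Qed.
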